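(* Let $\mathcal I\subseteq 2^\omega$ be a Turing ideal, and let $F_{\mathcal I}\subseteq\mathbb R$ be the set of all real numbers $x$ that are $A$-computable for some $A\in\mathcal I$. Then $F_{\mathcal I}$ is a real-closed subfield of $\mathbb R$, and $$\dim_{\mathrm H}\mathcal I=\dim_{\mathrm H}F_{\mathcal I}\in\{0,1\}.$$
   Context: For $X,Y\in 2^\omega$ (infinite binary sequences), $X\leq_{\mathrm T}Y$ means that $X$ is Turing computable from the oracle $Y$. The Turing join $X\oplus Y\in2^\omega$ is defined by $(X\oplus Y)(2n)=X(n)$ and $(X\oplus Y)(2n+1)=Y(n)$. A nonempty set $\mathcal I\subseteq 2^\omega$ is a Turing ideal if (i) $X\in\mathcal I$ and $Y\leq_{\mathrm T}X$ imply $Y\in\mathcal I$, and (ii) $X,Y\in\mathcal I$ imply $X\oplus Y\in\mathcal I$. No definability or measurability of $\mathcal I$ is assumed. For $A\in2^\omega$, a real $x$ is $A$-computable if there is a sequence of rationals $(q_n)_{n\in\omega}$, computable from the oracle $A$, with $|x-q_n|\le 2^{-n}$ for all $n$. Let $\mathbb R_A$ be the field of $A$-computable reals; then $F_{\mathcal I}=\bigcup_{A\in\mathcal I}\mathbb R_A$. $\dim_{\mathrm H}$ denotes Hausdorff dimension. For subsets of $2^\omega$ it is computed with respect to the metric $\rho(X,Y)=0$ if $X=Y$ and $\rho(X,Y)=2^{-\min\{n:X(n)\neq Y(n)\}}$ if $X\ne Y$; for subsets of $\mathbb R$ it is computed with respect to the usual metric. *)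

(* Defs.v *)
From HB Require Import structures.
From mathcomp Require Import all_boot all_order all_algebra.
From mathcomp Require Import all_classical all_reals all_analysis.
Set Implicit Arguments.
Unset Strict Implicit.
Unset Printing Implicit Defensive.
Import Order.TTheory GRing.Theory Num.Theory.
Import numFieldNormedType.Exports.

Local Open Scope classical_set_scope.
Local Open Scope ring_scope.

Notation cantor_seq := (nat -> bool).

(* Turing computability relative to an oracle is modelled by Kleene's partial
   recursive functions with the characteristic function of the oracle as an
   additional initial function ([Query]); [oracle_prog n] is the type of
   programs with n arguments. *)
Inductive oracle_prog : nat -> Type :=
| Zero n : oracle_prog n
| Succ : oracle_prog 1
| Proj n (i : 'I_n) : oracle_prog n
| Query : oracle_prog 1
| Comp m n (f : oracle_prog m) (g : 'I_m -> oracle_prog n) : oracle_prog n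
| PrimRec n (f : oracle_prog n) (g : oracle_prog n.+2) : oracle_prog n.+1
| Mu n (f : oracle_prog n.+1) : oracle_prog n.

(* [oracle_eval A p v y]: with oracle A, the program p halts on input v with
   output y.  Primitive recursion and minimization act on the first argument;
   the step function of [PrimRec] receives the counter, then the previous
   value. *)
Inductive oracle_eval (A : cantor_seq) :
  forall n, oracle_prog n -> n.-tuple nat -> nat -> Prop :=
| eval_zero n (v : n.-tuple nat) : oracle_eval A (Zero n) v 0%N
| eval_succ (v : 1.-tuple nat) : oracle_eval A Succ v (tnth v ord0).+1
| eval_proj n (i : 'I_n) (v : n.-tuple nat) :
    oracle_eval A (Proj i) v (tnth v i)
| eval_query (v : 1.-tuple nat) :
    oracle_eval A Query v (nat_of_bool (A (tnth v ord0)))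
| eval_comp m n (f : oracle_prog m) (g : 'I_m -> oracle_prog n)
    (v : n.-tuple nat) (w : m.-tuple nat) y :
    (forall i, oracle_eval A (g i) v (tnth w i)) -> oracle_eval A f w y ->
    oracle_eval A (Comp f g) v y
| eval_primrec0 n (f : oracle_prog n) (g : oracle_prog n.+2)
    (v : n.-tuple nat) y :
    oracle_eval A f v y -> oracle_eval A (PrimRec f g) [tuple of 0%N :: v] y
| eval_primrecS n (f : oracle_prog n) (g : oracle_prog n.+2)
    (v : n.-tuple nat) k r y :
    oracle_eval A (PrimRec f g) [tuple of k :: v] r ->
    oracle_eval A g [tuple of k :: r :: v] y ->
    oracle_eval A (PrimRec f g) [tuple of k.+1 :: v] y
| eval_mu n (f : oracle_prog n.+1) (v : n.-tuple nat) k (r : nat -> nat) :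
    (forall i, (i < k)%N -> oracle_eval A f [tuple of i :: v] (r i).+1) ->
    oracle_eval A f [tuple of k :: v] 0%N ->
    oracle_eval A (Mu f) v k.

Definition computable_from (A : cantor_seq) (f : nat -> nat) : Prop :=
  exists p : oracle_prog 1, forall n, oracle_eval A p [tuple n] (f n).

Definition turing_le (X Y : cantor_seq) : Prop :=
  computable_from Y (fun n => nat_of_bool (X n)).

Definition turing_join (X Y : cantor_seq) : cantor_seq :=
  fun n => if odd n then Y n./2 else X n./2.

Definition turing_ideal (I : set cantor_seq) : Prop :=
  [/\ I !=set0,
      forall X Y, I X -> turing_le Y X -> I Y &
      forall X Y, I X -> I Y -> I (turing_join X Y)].

(* A sequence of rationals is coded by its signs, numerators and
   denominators, the fractions not being required to be in lowest terms. *)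
Definition computable_rat_seq (A : cantor_seq) (q : nat -> rat) : Prop :=
  exists s a b : nat -> nat,
    [/\ computable_from A s, computable_from A a, computable_from A b &
        forall n, (0 < b n)%N /\ q n = (-1) ^+ s n * ((a n)%:R / (b n)%:R)].

Definition computable_reals (R : realType) (A : cantor_seq) : set R :=
  [set x | exists q : nat -> rat, computable_rat_seq A q /\
     forall n, `|x - ratr (q n)| <= 2 ^- n].
Arguments computable_reals : clear implicits.

Definition ideal_reals (R : realType) (I : set cantor_seq) : set R :=
  \bigcup_(A in I) computable_reals R A.
Arguments ideal_reals : clear implicits.

(* The range of a ring morphism between fields is a subfield, and [mono]
   transports the order of R, so F with the operations and order of R is
   isomorphic to the real closed field K. *)
Definition real_closed_subfield (R : realType) (F : set R) : Prop :=
  exists (K : rcfType) (f : {rmorphism K -> R}),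
    {mono f : x y / x <= y} /\ range f = F.

Section Hausdorff.
Context (R : realType) (T : Type) (d : T -> T -> R).
Local Open Scope ereal_scope.

Definition diam (U : set T) : \bar R :=
  ereal_sup [set (d z.1 z.2)%:E | z in U `*` U].

(* [diam set0 = -oo], and [0 `^ 0 = 1], so that for s = 0 every nonempty set
   has weight 1. *)
Definition hausdorff_weight (s : R) (U : set T) : \bar R :=
  if `[< U = set0 >] then 0 else diam U `^ s.

Definition hausdorff_content (s delta : R) (E : set T) : \bar R :=
  ereal_inf [set \sum_(0 <= i <oo) hausdorff_weight s (U i) |
    U in [set U : nat -> set T |
      E `<=` \bigcup_i U i /\ forall i, diam (U i) <= delta%:E]].

Definition hausdorff_measure (s : R) (E : set T) : \bar R :=
  ereal_sup [set hausdorff_content s delta E |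
    delta in [set delta : R | (0 < delta)%R]].

Definition hausdorff_dim (E : set T) : \bar R :=
  ereal_inf [set s%:E |
    s in [set s : R | (0 <= s)%R /\ hausdorff_measure s E = 0]].

End Hausdorff.

Definition cantor_dist (R : realType) (X Y : cantor_seq) : R :=
  if pselect (exists n, X n != Y n) is left neq then 2 ^- ex_minn neq else 0.

Definition real_dist (R : realType) (x y : R) : R := `|x - y|.

(* Main.v *)
From HB Require Import structures.
Require Import Defs.
From mathcomp Require Import all_boot all_order all_algebra.
From mathcomp Require Import all_classical all_reals all_analysis.
From mathcomp Require Import zify ring lra.
Set Implicit Arguments.
Unset Strict Implicit.
Unset Printing Implicit Defensive.

(** Why the theorem holds.

Real closedness.  Write F for the set of reals of the ideal.  Any two, hence
finitely many, members of F are computable from one oracle A of the ideal, the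
join of theirs, so sums and products stay in F.  Let c be a root of a nonzero
polynomial over F.  A rational c lies in F, so suppose that c is irrational and
that p has least degree among the polynomials over F that vanish at c.  Then
p'(c) is not 0, so near c the sign of p(t) is, up to a global sign, the sign of
t - c; and p vanishes at no rational point near c.  The sign of a nonvanishing
computable family of reals is computable ([family_sign]), so counting the
points of finer and finer rational grids at which p is negative computes c
([computable_bisection], [ideal_reals_root]).  Inverses are roots of x T - 1,
and the intermediate value property of F is inherited from R.

The two dimensions agree.  Code the first n bits of X by a number below 2 ^ n.
Up to an arbitrarily small change of the exponent, an s-null set is a set
covered infinitely often, by at most a constant times 2 ^ (s n) prefixes of
each length n ([sparsely_covered]).  The ideal is null in this sense exactly if
F is null: up to an integer translation the points of F are the values of the
binary expansions that lie in the ideal ([binary_expansion],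
[ideal_reals_real_of]), and a set of reals of diameter at most 2 ^ - n meets at
most three dyadic intervals of length 2 ^ - n.

The zero-one law.  The claim is that if the ideal is sparsely covered for some
exponent t < 1, it is so for every exponent 2 / a > 0.  The proof extracts
randomness from two independent sources.  By a union bound there are, and by
exhaustive search one can compute, functions F_k, each extending the previous
one, which read a prefix x of a first source and a much shorter prefix y of a
second one, and which disperse: if V is a set of outputs of which only a small
fraction extends each output of F_(k-1), then for few x are there many y with
F_k(x, y) in V ([exists_disperser]).  For X and Y in the ideal the sequence Z
of the outputs F_k(X, Y) is computable from their join, so Z lies in the ideal
and infinitely many of its prefixes lie in the sparse cover.  Fix such a prefix
of length n.  The number of members of the cover that extend a prefix of Z
starts below 2 ^ (t n) and ends above 0; as t < 1 it must drop slowly at some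
late level j, that is, the next block of Z is one of the few popular
continuations of the previous ones ([popular_exists]).  So at level j either
the prefix of X is one of the few x with many bad y, or the prefix of Y is one
of the few bad y of that x ([heavy_or_caught]).  If the ideal were not sparsely
covered with exponent 2 / a, it would contain an X that is from some level on
never in the first situation, and then, X being fixed, a Y that is from some
level on never in the second: a contradiction.  Choosing X and Y one after the
other takes the place of a product measure on pairs of sources. *)

(** * Functions recursive in an oracle *)

(** Stated for functions of tuples rather than for programs, so that
    computability can be proved by lemmas that follow the syntax of the
    function; the head of the tuple plays the role of the innermost variable. *)
Definition recursive (A : cantor_seq) n (f : n.-tuple nat -> nat) : Prop :=
  exists p : oracle_prog n, forall v, oracle_eval A p v (f v).

Definition tail n (w : n.+1.-tuple nat) : n.-tuple nat := [tuple of behead w].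

Lemma tail_cons n x (v : n.-tuple nat) : tail [tuple of x :: v] = v.
Proof. exact: val_inj. Qed.

Lemma cons_thead_tail n (w : n.+1.-tuple nat) : [tuple of thead w :: tail w] = w.
Proof. by rewrite [RHS]tuple_eta; apply: val_inj. Qed.

Lemma tuple1_eta (v : 1.-tuple nat) : v = [tuple thead v].
Proof.
apply: eq_from_tnth => i; rewrite (ord1 i).
by rewrite [RHS](tnth_nth 0).
Qed.

Fixpoint primrec E (b : E -> nat) (s : nat -> nat -> E -> nat) k (v : E) : nat :=
  if k is k'.+1 then s k' (primrec b s k' v) v else b v.

Definition sum_below (h : nat) (F : nat -> nat) : nat := (\sum_(i < h) F i)%N.
Definition all_below (h : nat) (P : nat -> bool) : bool := [forall i : 'I_h, P i].

Section Closure.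
Variable A : cantor_seq.
Local Notation rec := (recursive A).

Lemma rec_ext n (f g : n.-tuple nat -> nat) : f =1 g -> rec f -> rec g.
Proof. by move=> fg [p pf]; exists p => v; rewrite -fg. Qed.

Lemma rec_proj n (i : 'I_n) : rec (fun v => tnth v i).
Proof. by exists (Proj i) => v; constructor. Qed.

Lemma rec_comp m n (f : m.-tuple nat -> nat) (g : 'I_m -> n.-tuple nat -> nat) :
  rec f -> (forall i, rec (g i)) ->
  rec (fun v => f [tuple g i v | i < m]).
Proof.
move=> [p pf] /choice[q qg]; exists (Comp p q) => v.
by apply: eval_comp (pf _) => i; rewrite tnth_mktuple.
Qed.

Lemma rec_comp1 n (f : nat -> nat) (g : n.-tuple nat -> nat) :
  rec (fun v : 1.-tuple nat => f (thead v)) -> rec g -> rec (fun v => f (g v)).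
Proof.
move=> rf rg; apply: (rec_ext _ (@rec_comp _ _ _ (fun=> g) rf (fun=> rg))) => v.
by rewrite /thead tnth_mktuple.
Qed.

Lemma rec_succ n (f : n.-tuple nat -> nat) : rec f -> rec (fun v => (f v).+1).
Proof. by apply: (rec_comp1 (f := S)); exists Succ => v; constructor. Qed.

Lemma rec_const n c : rec (fun _ : n.-tuple nat => c).
Proof.
elim: c => [|c IH]; first by exists (Zero n) => v; constructor.
exact: rec_succ.
Qed.

Lemma rec_oracle n (f : n.-tuple nat -> nat) :
  rec f -> rec (fun v => nat_of_bool (A (f v))).
Proof.
by apply: (rec_comp1 (f := fun i => nat_of_bool (A i))); exists Query => v; constructor.
Qed.

Lemma rec_head n : rec (fun w : n.+1.-tuple nat => thead w).
Proof. exact: rec_proj. Qed.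

Lemma rec_tail n (f : n.-tuple nat -> nat) :
  rec f -> rec (fun w : n.+1.-tuple nat => f (tail w)).
Proof.
move=> rf; have := rec_comp rf (fun i => rec_proj (lift ord0 i)).
apply: rec_ext => w; congr f; apply: eq_from_tnth => i.
by rewrite tnth_mktuple tnth_behead; congr tnth; apply: val_inj; rewrite /= inordK // ltnS.
Qed.

(** Substitution for the innermost variable; this is how the result of a search
    is used. *)
Lemma rec_let n (f : n.+1.-tuple nat -> nat) (g : n.-tuple nat -> nat) :
  rec f -> rec g -> rec (fun v => f [tuple of g v :: v]).
Proof.
move=> rf rg.
pose h (i : 'I_n.+1) (v : n.-tuple nat) := tnth [tuple of g v :: v] i.
have rh i : rec (h i).
  have [->|[j ->]] : i = ord0 \/ exists j, i = lift ord0 j.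
  - by case: (unliftP ord0 i) => [j ->|->]; [right; exists j|left].
  - exact: rec_ext rg.
  by apply: rec_ext (rec_proj j) => v; rewrite /h tnthS.
apply: rec_ext (rec_comp rf rh) => v; congr f.
by apply: eq_from_tnth => i; rewrite tnth_mktuple.
Qed.

Lemma rec_primrec n (b : n.-tuple nat -> nat) (s : nat -> nat -> n.-tuple nat -> nat)
    (h : n.-tuple nat -> nat) :
  rec b ->
  rec (fun w : n.+2.-tuple nat => s (thead w) (thead (tail w)) (tail (tail w))) ->
  rec h -> rec (fun v => primrec b s (h v) v).
Proof.
move=> [p pb] [q qs] rh.
have rR : rec (fun w : n.+1.-tuple nat => primrec b s (thead w) (tail w)).
  exists (PrimRec p q) => w; rewrite -{1}(cons_thead_tail w).
  elim: (thead w) => [|k IH] /=; first exact: eval_primrec0.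
  apply: (eval_primrecS IH).
  set r := primrec b s k _; have := qs [tuple of k :: [tuple of r :: tail w]].
  rewrite !tail_cons !theadE.
  by rewrite (_ : [tuple of k :: [tuple of r :: _]] = [tuple of k :: r :: tail w]) //; apply: val_inj.
by apply: rec_ext (rec_let rR rh) => v; rewrite theadE tail_cons.
Qed.

Lemma rec_add n (f g : n.-tuple nat -> nat) :
  rec f -> rec g -> rec (fun v => f v + g v)%N.
Proof.
move=> rf rg; have := rec_primrec (s := fun _ r _ => r.+1) rg _ rf.
move/(_ (rec_succ (rec_tail (rec_head _)))); apply: rec_ext => v.
by elim: (f v) => //= k ->.
Qed.

(** The body sees the summation index as a new innermost variable.  Bounded sums
    yield products, quotients and bounded quantifiers below. *)
Lemma rec_sum n (F : nat -> n.-tuple nat -> nat) (h : n.-tuple nat -> nat) :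
  rec (fun w => F (thead w) (tail w)) -> rec h ->
  rec (fun v => sum_below (h v) (fun i => F i v)).
Proof.
move=> rF rh.
have rF2 : rec (fun w : n.+2.-tuple nat => F (thead w) (tail (tail w))).
  pose pr (i : 'I_n.+1) (w : n.+2.-tuple nat) :=
    if unlift ord0 i is Some j then tnth (tail (tail w)) j else thead w.
  have rpr i : rec (pr i).
    rewrite /pr; case: unlift => [j|]; last exact: rec_head.
    exact: rec_tail (rec_tail (rec_proj j)).
  apply: rec_ext (rec_comp rF rpr) => w.
  have -> : [tuple pr i w | i < n.+1] = [tuple of thead w :: tail (tail w)].
    apply: eq_from_tnth => i; rewrite tnth_mktuple /pr.
    by case: unliftP => [j ->|->] //; rewrite tnthS.
  by rewrite theadE tail_cons.
have := rec_primrec (s := fun k r v => (r + F k v)%N) (rec_const _ 0) _ rh.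
move/(_ (rec_add (rec_tail (rec_head _)) rF2)); apply: rec_ext => v.
by elim: (h v) => [|k /= ->]; rewrite /sum_below ?big_ord0 ?big_ord_recr.
Qed.

Lemma rec_mul n (f g : n.-tuple nat -> nat) :
  rec f -> rec g -> rec (fun v => f v * g v)%N.
Proof.
move=> rf rg; apply: rec_ext (rec_sum (F := fun _ v => g v) (rec_tail rg) rf) => v.
by rewrite /sum_below sum_nat_const card_ord.
Qed.

Lemma rec_exp n (f g : n.-tuple nat -> nat) :
  rec f -> rec g -> rec (fun v => f v ^ g v)%N.
Proof.
move=> rf rg; have := rec_primrec (s := fun _ r v => (r * f v)%N) (rec_const _ 1) _ rg.
move/(_ (rec_mul (rec_tail (rec_head _)) (rec_tail (rec_tail rf)))).
by apply: rec_ext => v; elim: (g v) => //= k ->; rewrite expnSr.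
Qed.

Lemma rec_sub n (f g : n.-tuple nat -> nat) :
  rec f -> rec g -> rec (fun v => f v - g v)%N.
Proof.
have rpred m (h : m.-tuple nat -> nat) : rec h -> rec (fun v => (h v).-1).
  move=> rh; have := rec_primrec (s := fun k _ _ => k) (rec_const _ 0) (rec_head _) rh.
  by apply: rec_ext => v; case: (h v).
move=> rf rg; have := rec_primrec (s := fun _ r _ => r.-1) rf _ rg.
move/(_ (rpred _ _ (rec_tail (rec_head _)))); apply: rec_ext => v.
by elim: (g v) => [|k /= ->]; rewrite ?subn0 ?subnS.
Qed.

Lemma rec_neg n (P : n.-tuple nat -> bool) :
  rec (fun v => nat_of_bool (P v)) -> rec (fun v => nat_of_bool (~~ P v)).
Proof.
by move=> rP; apply: rec_ext (rec_sub (rec_const _ 1) rP) => v; case: (P v).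
Qed.

Lemma rec_leq n (f g : n.-tuple nat -> nat) :
  rec f -> rec g -> rec (fun v => nat_of_bool (f v <= g v)).
Proof.
move=> rf rg.
apply: rec_ext (rec_sub (rec_const _ 1) (rec_sub rf rg)) => v.
by rewrite [X in nat_of_bool X]/leq; case: (f v - g v) => // k; rewrite subSS sub0n.
Qed.

Lemma rec_and n (P Q : n.-tuple nat -> bool) :
  rec (fun v => nat_of_bool (P v)) -> rec (fun v => nat_of_bool (Q v)) ->
  rec (fun v => nat_of_bool (P v && Q v)).
Proof.
by move=> rP rQ; apply: rec_ext (rec_mul rP rQ) => v; rewrite mulnb.
Qed.

Lemma rec_or n (P Q : n.-tuple nat -> bool) :
  rec (fun v => nat_of_bool (P v)) -> rec (fun v => nat_of_bool (Q v)) ->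
  rec (fun v => nat_of_bool (P v || Q v)).
Proof.
move=> rP rQ; apply: rec_ext (rec_neg (rec_and (rec_neg rP) (rec_neg rQ))) => v.
by rewrite negb_and !negbK.
Qed.

Lemma rec_eq n (f g : n.-tuple nat -> nat) :
  rec f -> rec g -> rec (fun v => nat_of_bool (f v == g v)).
Proof.
move=> rf rg; apply: rec_ext (rec_and (rec_leq rf rg) (rec_leq rg rf)) => v.
by rewrite eqn_leq.
Qed.

Lemma rec_forall n (P : nat -> n.-tuple nat -> bool) (h : n.-tuple nat -> nat) :
  rec (fun w => nat_of_bool (P (thead w) (tail w))) -> rec h ->
  rec (fun v => nat_of_bool (all_below (h v) (fun i => P i v))).
Proof.
move=> rP rh; apply: rec_ext (rec_eq (rec_sum (F := fun i v => nat_of_bool (~~ P i v)) (rec_neg rP) rh)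
  (rec_const _ 0)) => v.
rewrite /sum_below sum_nat_eq0; congr nat_of_bool.
by apply: eq_forallb => i; case: (P i v).
Qed.

Lemma rec_div n (f g : n.-tuple nat -> nat) :
  rec f -> rec g -> rec (fun v => f v %/ g v)%N.
Proof.
move=> rf rg.
have rF : rec (fun v => sum_below (f v) (fun i => nat_of_bool ((0 < g v) && (i.+1 * g v <= f v))%N)).
  apply: (rec_sum (F := fun i v => nat_of_bool ((0 < g v) && (i.+1 * g v <= f v))%N) _ rf).
  apply: rec_and; first exact: rec_leq (rec_const _ 1) (rec_tail rg).
  exact: rec_leq (rec_mul (rec_succ (rec_head _)) (rec_tail rg)) (rec_tail rf).
apply: rec_ext rF => v; case: (posnP (g v)) => [->|g0].
  by rewrite /sum_below divn0 big1.
rewrite /sum_below.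
under eq_bigr => i _ do rewrite andTb -leq_divRL //.
have sumlt m q : (\sum_(i < m) (i < q) = minn m q)%N.
  by elim: m => [|m IH]; rewrite ?big_ord0 ?min0n // big_ord_recr /= IH; lia.
by rewrite sumlt; apply/minn_idPr/leq_div.
Qed.

Lemma rec_mod n (f g : n.-tuple nat -> nat) :
  rec f -> rec g -> rec (fun v => f v %% g v)%N.
Proof.
move=> rf rg; apply: rec_ext (rec_sub rf (rec_mul (rec_div rf rg) rg)) => v.
by rewrite {1}(divn_eq (f v) (g v)) addKn.
Qed.

Lemma rec_odd n (f : n.-tuple nat -> nat) :
  rec f -> rec (fun v => nat_of_bool (odd (f v))).
Proof.
by move=> rf; apply: rec_ext (rec_mod rf (rec_const _ 2)) => v; rewrite modn2.
Qed.

Lemma rec_implb n (P Q : n.-tuple nat -> bool) :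
  rec (fun v => nat_of_bool (P v)) -> rec (fun v => nat_of_bool (Q v)) ->
  rec (fun v => nat_of_bool (P v ==> Q v)).
Proof.
move=> rP rQ; apply: rec_ext (rec_or (rec_neg rP) rQ) => v.
by rewrite implybE.
Qed.

(** The least solution is computed even though the bound on the search is not.
    The two properties determine the function, so the same function is recursive
    in every oracle in which the predicate is. *)
Lemma rec_mu n (f : nat -> n.-tuple nat -> bool) :
  rec (fun w : n.+1.-tuple nat => nat_of_bool (f (thead w) (tail w))) ->
  (forall v, exists k, f k v) ->
  exists g, rec g /\ forall v, f (g v) v /\ forall i, f i v -> (g v <= i)%N.
Proof.
move=> rf exf; pose g v := ex_minn (exf v); exists g; split; last first.
  by move=> v; rewrite /g; case: ex_minnP.
case: (rec_neg rf) => p pf; exists (Mu p) => v; rewrite /g; case: ex_minnP => k fk kmin.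
have E i : oracle_eval A p [tuple of i :: v] (~~ f i v).
  by have := pf [tuple of i :: v]; rewrite theadE tail_cons.
apply: (@eval_mu A n p v k (fun=> 0)) => [i ik|]; last by have := E k; rewrite fk.
by have := E i; case fi: (f i v) => //; move: (kmin i fi); rewrite leqNgt ik.
Qed.

Lemma computable_fromP (f : nat -> nat) :
  computable_from A f <-> rec (fun v : 1.-tuple nat => f (thead v)).
Proof.
split=> -[p pf]; exists p; last by move=> n; apply: pf.
move=> v; rewrite {1}(tuple1_eta v); exact: pf.
Qed.

End Closure.

(** Applies the closure lemmas by recursion on the body of the function; the
    leaves are constants and the variables given by [thead] and [tail]. *)
Ltac rec_tac :=
  let solve_var := first [ exact: rec_head | exact: rec_tail (rec_head _ _)
    | exact: rec_tail (rec_tail (rec_head _ _))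
    | exact: rec_tail (rec_tail (rec_tail (rec_head _ _)))
    | exact: rec_tail (rec_tail (rec_tail (rec_tail (rec_head _ _))))
    | exact: rec_tail (rec_tail (rec_tail (rec_tail (rec_tail (rec_head _ _)))))
    | exact: rec_tail (rec_tail (rec_tail (rec_tail (rec_tail (rec_tail (rec_head _ _))))))] in
  cbv beta;
  match goal with
  | |- recursive _ (fun v => thead _) => solve_var
  | |- recursive _ (fun v => ?c) => exact: rec_const
  | |- recursive ?A (fun v => addn (@?f v) (@?g v)) => apply (@rec_add A _ f g); rec_tac
  | |- recursive ?A (fun v => muln (@?f v) (@?g v)) => apply (@rec_mul A _ f g); rec_tac
  | |- recursive ?A (fun v => subn (@?f v) (@?g v)) => apply (@rec_sub A _ f g); rec_tac
  | |- recursive ?A (fun v => expn (@?f v) (@?g v)) => apply (@rec_exp A _ f g); rec_tac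
  | |- recursive ?A (fun v => divn (@?f v) (@?g v)) => apply (@rec_div A _ f g); rec_tac
  | |- recursive ?A (fun v => modn (@?f v) (@?g v)) => apply (@rec_mod A _ f g); rec_tac
  | |- recursive ?A (fun v => S (@?f v)) => apply (@rec_succ A _ f); rec_tac
  | |- recursive ?A (fun v => sum_below (@?h v) (fun i => @?F v i)) =>
      apply (@rec_sum A _ (fun i v => F v i) h); rec_tac
  | |- recursive ?A (fun v => nat_of_bool (negb (@?f v))) => apply (@rec_neg A _ f); rec_tac
  | |- recursive ?A (fun v => nat_of_bool (andb (@?f v) (@?g v))) => apply (@rec_and A _ f g); rec_tac
  | |- recursive ?A (fun v => nat_of_bool (orb (@?f v) (@?g v))) => apply (@rec_or A _ f g); rec_tac
  | |- recursive ?A (fun v => nat_of_bool (implb (@?f v) (@?g v))) => apply (@rec_implb A _ f g); rec_tac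
  | |- recursive ?A (fun v => nat_of_bool (leq (@?f v) (@?g v))) => apply (@rec_leq A _ f g); rec_tac
  | |- recursive ?A (fun v => nat_of_bool (eq_op (@?f v) (@?g v))) => apply (@rec_eq A _ f g); rec_tac
  | |- recursive ?A (fun v => nat_of_bool (odd (@?f v))) => apply (@rec_odd A _ f); rec_tac
  | |- recursive ?A (fun v => nat_of_bool (all_below (@?h v) (fun i => @?F v i))) =>
      apply (@rec_forall A _ (fun i v => F v i) h); rec_tac
  | |- _ => idtac
  end.

Section Lift.
Variables (A B : cantor_seq).

Fixpoint subst_query (q : oracle_prog 1) n (p : oracle_prog n) : oracle_prog n :=
  match p with
  | Zero n => Zero n
  | Succ => Succ
  | Proj n i => Proj i
  | Query => q
  | Comp m n f g => Comp (subst_query q f) (fun i => subst_query q (g i))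
  | PrimRec n f g => PrimRec (subst_query q f) (subst_query q g)
  | Mu n f => Mu (subst_query q f)
  end.

(** Transitivity of relative computability: each query to the first oracle is
    answered by running the program that computes it from the second. *)
Lemma eval_subst_query q n (p : oracle_prog n) v y :
  (forall i, oracle_eval B q [tuple i] (A i)) ->
  oracle_eval A p v y -> oracle_eval B (subst_query q p) v y.
Proof.
move=> qA; elim=> {n p v y} //=; try by move=> *; econstructor; eauto.
by move=> v; rewrite {1}(tuple1_eta v); apply: qA.
Qed.

Lemma recursive_turing_le n (f : n.-tuple nat -> nat) :
  turing_le A B -> recursive A f -> recursive B f.
Proof.
move=> [q qA] [p pf]; exists (subst_query q p) => v.
exact: eval_subst_query.
Qed.
End Lift.

Lemma turing_le_refl A : turing_le A A.
Proof. by apply/computable_fromP/rec_oracle/rec_head. Qed.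

Lemma turing_le_joinl A B : turing_le A (turing_join A B).
Proof.
have := rec_oracle (A := turing_join A B) (rec_mul (rec_const _ _ 2) (rec_head _ 0)).
move=> h; apply/computable_fromP; apply: rec_ext h => v.
by rewrite /turing_join oddM /= mul2n doubleK.
Qed.

Lemma turing_le_joinr A B : turing_le B (turing_join A B).
Proof.
have := rec_oracle (A := turing_join A B) (rec_succ (rec_mul (rec_const _ _ 2) (rec_head _ 0))).
move=> h; apply/computable_fromP; apply: rec_ext h => v.
by rewrite /turing_join /= oddM /= mul2n uphalf_double.
Qed.

(** * A dispersing table exists *)

Section Extractor.
Variables (N W S q L K v : nat) (G : 'I_N -> 'I_W -> 'I_S).
Local Notation table := {ffun 'I_N * 'I_W -> 'I_q}.
Local Notation witness :=
  ({set 'I_S * 'I_q} * {ffun 'I_L -> 'I_N} * {ffun 'I_L * 'I_K -> 'I_W})%type.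

(** A witness against a table e consists of a set V of pairs with small fibres,
    of L rows, and of K columns for each of these rows; its cells are the L * K
    places thus selected, and e is hit if all its values there fall in V. *)
Definition cell (t : witness) (i : 'I_L * 'I_K) : 'I_N * 'I_W :=
  (t.1.2 i.1, t.2 i).

Definition witnesses (t : witness) : bool :=
  [forall s, #|[set z | (s, z) \in t.1.1]%SET| <= v] && injectiveb (cell t).

Definition hits (t : witness) (e : table) : bool :=
  [forall i, (G (cell t i).1 (cell t i).2, e (cell t i)) \in t.1.1].

(** At each of the L * K cells a table that is hit has at most v values instead
    of q. *)
Lemma card_hits t : witnesses t ->
  (#|[set e | hits t e]%SET| * q ^ (L * K) <= v ^ (L * K) * #|{: table}|)%N.
Proof.
move=> /andP[/forallP small /injectiveP inj].
pose P := (cell t @: [set: 'I_L * 'I_K])%SET.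
pose F p := if p \in P then [set z | (G p.1 p.2, z) \in t.1.1]%SET else [set: 'I_q]%SET.
have cP : #|P| = (L * K)%N by rewrite card_imset // cardsT card_prod !card_ord.
have sub : [set e | hits t e]%SET \subset family F.
  apply/fintype.subsetP => e; rewrite inE => /forallP he; apply/familyP => p.
  rewrite /F; case: ifP => // /imsetP[i _ ->]; rewrite inE; exact: he.
have := subset_leq_card sub; rewrite card_family => le.
have {}le : #|[set e | hits t e]%SET| <= v ^ (L * K) * q ^ #|(~: P)%SET|.
  apply: leq_trans le _.
  rewrite [X in X <= _](_ : _ = \prod_p #|F p|); last first.
    by rewrite foldrE big_image.
  rewrite (bigID (mem P)) /= leq_mul //.
    rewrite -cP -prod_nat_const; apply: leq_prod => p pP.
    by rewrite /F pP; exact: small.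
  have -> : q ^ #|(~: P)%SET| = \prod_(p | p \notin P) q.
    by rewrite -prod_nat_const; apply: eq_bigl => p; rewrite inE.
  apply: leq_prod => p pP.
  by rewrite /F (negPf pP) cardsT card_ord.
apply: leq_trans (leq_mul le (leqnn _)) _.
rewrite -mulnA -expnD -[X in (_ + X)%N]cP addnC cardsC card_ffun card_ord.
by rewrite leq_mul2l leqnn orbT.
Qed.

(** A union bound: there are 2 ^ (S q) sets V, N ^ L choices of rows and
    W ^ (L K) choices of columns, and by [card_hits] each of these witnesses
    hits only a fraction (v / q) ^ (L K) of all tables. *)
Lemma exists_dispersing_table : (0 < q)%N ->
  (2 ^ (S * q) * N ^ L * W ^ (L * K) * v ^ (L * K) < q ^ (L * K))%N ->
  exists e : table, forall V : {set 'I_S * 'I_q},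
    (forall s, #|[set z | (s, z) \in V]%SET| <= v)%N ->
    (#|[set x | K <= #|[set y | (G x y, e (x, y)) \in V]%SET|]%SET| < L)%N.
Proof.
move=> q_gt0 bound; apply: contrapT => none.
have bad e : exists t, witnesses t && hits t e.
  have [V [Vs]] : exists V : {set 'I_S * 'I_q},
      (forall s, #|[set z | (s, z) \in V]%SET| <= v)%N /\
      (L <= #|[set x | K <= #|[set y | (G x y, e (x, y)) \in V]%SET|]%SET|)%N.
    apply: contrapT => hV; apply: none; exists e => V Vs.
    by rewrite ltnNge; apply/negP => LV; apply: hV; exists V.
  set X := [set x | _]%SET => LX.
  have Xn (l : 'I_L) : (l < #|X|)%N by exact: leq_trans (ltn_ord l) LX.
  pose f := [ffun l : 'I_L => enum_val (Ordinal (Xn l))].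
  pose Y x := [set y | (G x y, e (x, y)) \in V]%SET.
  have Yn (i : 'I_L * 'I_K) : (i.2 < #|Y (f i.1)|)%N.
    have := enum_valP (Ordinal (Xn i.1)); rewrite inE => h.
    by rewrite ffunE; exact: leq_trans (ltn_ord i.2) h.
  pose g := [ffun i => enum_val (Ordinal (Yn i))].
  exists (V, f, g); apply/andP; split; last first.
    apply/forallP => i /=; have := enum_valP (Ordinal (Yn i)).
    by rewrite inE /cell /= [g i]ffunE.
  apply/andP; split; first by apply/forallP => s; exact: Vs.
  apply/injectiveP => -[l k] [l' k'] [] /=.
  rewrite [f l]ffunE [f l']ffunE => /enum_val_inj[/val_inj ll]; subst l'.
  by rewrite [g (l, k)]ffunE [g (l, k')]ffunE => h; have [/val_inj ->] := @enum_val_inj _ (mem (Y (f l))) _ _ h.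
have total : (#|{: table}| <= \sum_(t | witnesses t) #|[set e | hits t e]%SET|)%N.
  rewrite -sum1_card.
  under [X in (_ <= X)%N]eq_bigr => t _ do rewrite -sum1_card big_mkcond.
  rewrite exchange_big /=; apply: leq_sum => e _.
  have [t /andP[wt ht]] := bad e.
  by rewrite (bigD1 t) //= inE ht.
have tab0 : (0 < #|{: table}|)%N.
  by rewrite card_ffun card_ord expn_gt0 q_gt0.
have nw : (#|{: witness}| = 2 ^ (S * q) * N ^ L * W ^ (L * K))%N.
  rewrite !card_prod -[#|{: {set _}}|]cardsT -powersetT card_powerset cardsT.
  by rewrite !card_ffun !card_prod !card_ord.
move: bound; rewrite ltnNge => /negP[].
rewrite -(leq_pmul2r tab0) mulnC.
apply: leq_trans (leq_mul total (leqnn _)) _.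
rewrite big_distrl /=.
apply: (@leq_trans (\sum_(t | witnesses t) v ^ (L * K) * #|{: table}|)).
  by apply: leq_sum => t; exact: card_hits.
rewrite sum_nat_const -nw mulnA leq_mul2r leq_mul2r; apply/orP; right; apply/orP; right.
exact: max_card.
Qed.

End Extractor.

(** * A computable sequence of dispersing tables *)

Lemma sum_belowS h F : sum_below h.+1 F = (sum_below h F + F h)%N.
Proof. by rewrite /sum_below big_ord_recr. Qed.

Lemma sum_below_card h (P : nat -> bool) : sum_below h (fun i => P i) = #|[set i : 'I_h | P i]%SET|.
Proof. by rewrite -sum1dep_card [RHS]big_mkcond /sum_below; apply: eq_bigr => i _; case: (P i). Qed.

Lemma all_belowP h (P : nat -> bool) : reflect (forall i, (i < h)%N -> P i) (all_below h P).
Proof.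
apply: (iffP forallP) => [all i ih|all i]; last exact: all.
exact: all (Ordinal ih).
Qed.

(** Finite functions with values below Q are coded by their digits in base Q,
    finite sets being the case Q = 2; quantifying over codes makes the search
    for a good table a bounded search in arithmetic. *)
Definition digit Q c i := ((c %/ Q ^ i) %% Q)%N.

Lemma digit_lt Q c i : (0 < Q)%N -> (digit Q c i < Q)%N.
Proof. by move=> Q0; rewrite ltn_mod. Qed.

Lemma exists_code D Q (h : nat -> nat) : (forall i, (i < D)%N -> (h i < Q)%N) ->
  exists2 c, (c < Q ^ D)%N & forall i, (i < D)%N -> digit Q c i = h i.
Proof.
elim: D h => [|D IH] h hQ; first by exists 0.
have [c cQ ch] := IH (fun i => h i.+1) (fun i iD => hQ i.+1 iD).
have h0 := hQ 0 (ltn0Sn _).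
exists (c * Q + h 0)%N; first by rewrite expnS; nia.
have Q0 : (0 < Q)%N by case: (Q) h0.
case=> [_|i iD]; rewrite /digit.
  by rewrite expn0 divn1 modnMDl modn_small.
by rewrite expnS divnMA divnMDl // (divn_small h0) addn0; apply: ch.
Qed.

Lemma exists_bits D (P : nat -> bool) :
  exists2 c, (c < 2 ^ D)%N & forall i, (i < D)%N -> digit 2 c i = P i.
Proof. by apply: exists_code => i _; case: (P i). Qed.

Lemma odd_digit c i : odd (c %/ 2 ^ i) = digit 2 c i :> nat.
Proof. by rewrite /digit modn2. Qed.

Section Tables.
Variables (a r : nat).

(** At level k the tables read a * out k bits of the first source and a * k bits
    of the second and produce out k bits, the last [block k] of them new.  A
    block has r * gain k bits; a set of blocks counts as small if it has at most
    2 ^ ((r - 1) * gain k) members, which is what makes gain k bits of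
    information per cell available in the union bound.  They must outweigh the
    a * k bits that specify a column, with a constant to spare. *)
Definition gain k := (a * k + 3)%N.
Definition block k := (r * gain k)%N.
Definition out k := sum_below k (fun i => block i.+1).
(** From this many bad columns on a row is bad.  The factor 2 ^ k has rate 1 / a
    among the a * k bits of a column; the factor a * out k pays in the union
    bound for the choice of the rows. *)
Definition fan k := (a * out k * 2 ^ k)%N.

Lemma outS k : out k.+1 = (out k + block k.+1)%N.
Proof. exact: sum_belowS. Qed.

Definition table k c x y := digit (2 ^ out k) c (x * 2 ^ (a * k) + y).

Definition sparse_fibres k (V : nat -> bool) :=
  all_below (2 ^ out k) (fun s =>
    sum_below (2 ^ block k.+1) (fun z => V (s * 2 ^ block k.+1 + z)%N)
      <= 2 ^ ((r - 1) * gain k.+1))%N.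

(** Among the a * out k.+1 bits of a row the bound on the number of bad rows has
    rate 1 / a again. *)
Definition disperses k (F : nat -> nat -> nat) (V : nat -> bool) :=
  (sum_below (2 ^ (a * out k.+1)) (fun x =>
     fan k.+1 <= sum_below (2 ^ (a * k.+1)) (fun y => V (F x y)))
   < 2 ^ out k.+1)%N.

Definition extends k (F F' : nat -> nat -> nat) :=
  all_below (2 ^ (a * out k.+1)) (fun x => all_below (2 ^ (a * k.+1)) (fun y =>
    F' x y %/ 2 ^ block k.+1 == F (x %/ 2 ^ (a * block k.+1)) (y %/ 2 ^ a)))%N.

Definition good_code k c c' :=
  extends k (table k c) (table k.+1 c') &&
  all_below (2 ^ (2 ^ out k.+1)) (fun w =>
    sparse_fibres k (fun t => odd (w %/ 2 ^ t)) ==>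
    disperses k (table k.+1 c') (fun t => odd (w %/ 2 ^ t))).

Lemma rec_good_code A :
  recursive A (fun v : 3.-tuple nat =>
    good_code (thead (tail v)) (thead (tail (tail v))) (thead v)).
Proof.
rewrite /good_code /extends /sparse_fibres /disperses /table /digit /fan /out /block /gain.
rec_tac.
Qed.

(** Every set of outputs agrees with one of the coded ones on the possible
    outputs. *)
Lemma good_codeP k c c' : good_code k c c' ->
  extends k (table k c) (table k.+1 c') /\
  forall V, sparse_fibres k V -> disperses k (table k.+1 c') V.
Proof.
move=> /andP[ext /all_belowP good]; split=> // V /all_belowP sp.
have [w w2 wV] := exists_bits (2 ^ out k.+1) V.
have bit i : (i < 2 ^ out k.+1)%N -> odd (w %/ 2 ^ i) = V i.
  by move=> /wV; rewrite -odd_digit; case: odd; case: (V i).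
have := good w w2; rewrite (_ : sparse_fibres _ _) ?implyTb; last first.
  apply/all_belowP => s sS; apply: leq_trans (sp s sS); apply/eq_leq.
  rewrite !sum_below_card; apply: eq_card => z; rewrite !inE bit //.
  by rewrite outS expnD; have := ltn_ord z; nia.
rewrite /disperses; apply: leq_ltn_trans; apply/eq_leq.
rewrite !sum_below_card; apply: eq_card => x; rewrite !inE !sum_below_card.
congr (_ <= _)%N; apply: eq_card => y; rewrite !inE bit //.
by apply: digit_lt; rewrite expn_gt0.
Qed.

Hypotheses (a_gt0 : (0 < a)%N) (r_gt0 : (0 < r)%N).

(** In exponents: with L = 2 ^ out k.+1 and K = fan k.+1, the sets V and the rows
    cost at most L K bits together and the columns a (k + 1) L K bits, against
    the gain of a (k + 1) + 3 bits at each of the L K cells. *)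
Lemma union_bound k (S := 2 ^ out k) (q := 2 ^ block k.+1) (N := 2 ^ (a * out k.+1))
    (W := 2 ^ (a * k.+1)) (L := 2 ^ out k.+1) (K := fan k.+1)
    (v := 2 ^ ((r - 1) * gain k.+1)) :
  (2 ^ (S * q) * N ^ L * W ^ (L * K) * v ^ (L * K) < q ^ (L * K))%N.
Proof.
rewrite /S /q -expnD -outS -/L /N /W /v -!expnM -!expnD ltn_exp2l //.
have -> : (block k.+1 = (r - 1) * gain k.+1 + gain k.+1)%N.
  by rewrite /block -[in LHS](subnK r_gt0) mulnDl mul1n.
have ok : (0 < out k.+1)%N by rewrite outS /block /gain; nia.
have L0 : (0 < L)%N by rewrite expn_gt0.
have aL : (2 * (a * out k.+1) <= K)%N.
  by rewrite /K /fan expnS; have := expn_gt0 2 k; nia.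
rewrite /gain; set g := ((r - 1) * _)%N; set m := (a * k.+1)%N.
set n := (a * out k.+1)%N in aL *.
have n0 : (0 < n)%N by rewrite /n; nia.
have h1 : (L + n * L <= L * K)%N by nia.
have LK0 : (0 < L * K)%N by nia.
move: LK0 h1; set LK := (L * K)%N; nia.
Qed.

(** The new block of the table is chosen by [exists_dispersing_table], applied
    with G the value of the previous table on the shortened arguments. *)
Lemma exists_good_code k c : exists c', good_code k c c'.
Proof.
set q := (2 ^ block k.+1)%N; set S := (2 ^ out k)%N.
set N := (2 ^ (a * out k.+1))%N; set W := (2 ^ (a * k.+1))%N.
have q0 : (0 < q)%N by rewrite expn_gt0.
have W0 : (0 < W)%N by rewrite expn_gt0.
pose G0 x y := table k c (x %/ 2 ^ (a * block k.+1)) (y %/ 2 ^ a).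
have G0S x y : (G0 x y < S)%N by apply: digit_lt; rewrite expn_gt0.
pose G (x : 'I_N) (y : 'I_W) : 'I_S := Ordinal (G0S x y).
have [e he] := exists_dispersing_table G q0 (union_bound k).
(* Row-major enumeration of the table; the default 0 is never read. *)
pose h i := if insub (i %/ W)%N is Some x then
            if insub (i %% W)%N is Some y then (G x y * q + e (x, y))%N else 0 else 0.
have hxy (x : 'I_N) (y : 'I_W) : h (x * W + y)%N = (G x y * q + e (x, y))%N.
  rewrite /h divnMDl // (divn_small (ltn_ord y)) addn0 modnMDl modn_small //.
  by rewrite !valK.
have Q : (2 ^ out k.+1 = S * q)%N by rewrite outS expnD.
have [c' _ hc'] : exists2 c', (c' < (2 ^ out k.+1) ^ (N * W))%N &
    forall i, (i < N * W)%N -> digit (2 ^ out k.+1) c' i = h i.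
  apply: exists_code => i iNW; rewrite /h Q.
  have S0 : (0 < S * q)%N by rewrite muln_gt0 q0 expn_gt0.
  case: insubP => // x _ _; case: insubP => // y _ _.
  have := ltn_ord (G x y); have := ltn_ord (e (x, y)); nia.
have tab (x : 'I_N) (y : 'I_W) : table k.+1 c' x y = (G x y * q + e (x, y))%N.
  rewrite /table hc' ?hxy //.
  have := ltn_ord x; have := ltn_ord y; nia.
exists c'; apply/andP; split.
  apply/all_belowP => x xN; apply/all_belowP => y yW.
  by rewrite (tab (Ordinal xN) (Ordinal yW)) divnMDl // divn_small ?addn0.
apply/all_belowP => w _; apply/implyP => /all_belowP sp; rewrite /disperses.
pose V := [set p : 'I_S * 'I_q | odd (w %/ 2 ^ (p.1 * q + p.2))]%SET.
have Vs s : (#|[set z | (s, z) \in V]%SET| <= 2 ^ ((r - 1) * gain k.+1))%N.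
  apply: leq_trans (sp s (ltn_ord s)); rewrite sum_below_card.
  by apply/eq_leq/eq_card => z; rewrite !inE.
apply: leq_ltn_trans (he V Vs); rewrite sum_below_card.
apply/eq_leq/eq_card => x; rewrite !inE sum_below_card.
by congr (_ <= _)%N; apply: eq_card => y; rewrite !inE tab.
Qed.

End Tables.

(** The codes of the tables are found by recursion on the level, each being the
    least one that is good for its predecessor. *)
Theorem exists_disperser a r : (0 < a)%N -> (0 < r)%N ->
  exists F : nat -> nat -> nat -> nat,
  [/\ forall A, recursive A (fun v : 3.-tuple nat => F (thead v) (thead (tail v)) (thead (tail (tail v)))),
      forall k x y, (F k x y < 2 ^ out a r k)%N,
      forall k, extends a r k (F k) (F k.+1) &
      forall k V, sparse_fibres a r k V -> disperses a r k (F k.+1) V].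
Proof.
move=> a0 r0.
(* The oracle does not matter: least solutions are unique. *)
pose next A := rec_mu (f := fun c' v => good_code a r (thead v) (thead (tail v)) c')
  (rec_good_code a r A) (fun v => exists_good_code a0 r0 _ _).
have [g [_ gP]] := next (fun=> false).
have rg A : recursive A g.
  have [g' [rg' g'P]] := next A.
  apply: rec_ext rg' => v; have [h1 h2] := gP v; have [h3 h4] := g'P v.
  by apply/eqP; rewrite eqn_leq h4 // h2.
pose code k := primrec (fun _ : 0.-tuple nat => 0) (fun k c _ => g [tuple k; c]) k [tuple].
have codeS k : good_code a r k (code k) (code k.+1) by have [] := gP [tuple k; code k].
exists (fun k => table a r k (code k)); split.
- move=> A.
  have rc : recursive A (fun v : 3.-tuple nat => code (thead v)).
    have := @rec_primrec A 3 (fun=> 0) (fun k c _ => g [tuple k; c]) (fun v => thead v)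
      (rec_const _ _ _) _ (rec_head _ _).
    move=> h; apply: rec_ext (h _) => {h}.
      by move=> v; rewrite /code; elim: (thead v) => //= k ->.
    pose pr (i : 'I_2) (w : 5.-tuple nat) := if i == ord0 then thead w else thead (tail w).
    have := @rec_comp A 2 5 g pr (rg A) _.
    move=> h; apply: rec_ext (h _) => {h}.
      move=> w; congr g; apply: eq_from_tnth => i; rewrite tnth_mktuple /pr.
      by case: i => -[|[|//]] ?.
    by rewrite /pr => i; case: eqP => _; [exact: rec_head|exact: rec_tail (rec_head _ _)].
  rewrite /table /digit /out /block /gain.
  apply: (@rec_mod A _ (fun v => _ %/ _)%N (fun v => _)); last by rec_tac.
  apply: rec_div => //; rec_tac.
- by move=> k x y; apply: digit_lt; rewrite expn_gt0.
- by move=> k; case: (good_codeP (codeS k)).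
- by move=> k; case: (good_codeP (codeS k)).
Qed.

(** * Prefixes, and the two-source argument *)

(** The first n bits of X read as a binary number with the oldest bit first, so
    that shortening a prefix is a division by a power of 2. *)
Fixpoint head_bits (X : cantor_seq) n : nat :=
  if n is n'.+1 then 2 * head_bits X n' + X n' else 0.

Lemma head_bits_lt X n : head_bits X n < 2 ^ n.
Proof. by elim: n => //= n; rewrite expnS; case: (X n); lia. Qed.

Lemma head_bits_div X n k : head_bits X (n + k) %/ 2 ^ k = head_bits X n.
Proof.
elim: k => [|k IH]; first by rewrite addn0 divn1.
rewrite addnS /= expnS divnMA mulnC divnMDl //.
rewrite (_ : X (n + k) %/ 2 = 0) ?addn0 //.
by case: (X _).
Qed.

Lemma head_bits_eqP X Y n : head_bits X n = head_bits Y n <-> forall i, i < n -> X i = Y i.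
Proof.
elim: n => [|n IH] /=; first by split.
split=> [e i|e].
  have [e1 e2] : head_bits X n = head_bits Y n /\ X n = Y n.
    by move: e; case: (X n); case: (Y n) => /= e; split=> //; lia.
  by rewrite ltnS leq_eqVlt => /orP[/eqP ->//|]; move: i; apply/IH.
by rewrite e // (IH.2 _) // => i /ltnW; apply: e.
Qed.

Lemma head_bits_bits X n c : c < 2 ^ n ->
  (forall j, j < n -> X j = odd (c %/ 2 ^ (n - j.+1))) -> head_bits X n = c.
Proof.
elim: n c => [|n IH] c /=; first by case: c.
rewrite expnS => cn Xc; rewrite (Xc n) // subnn divn1.
rewrite (IH (c %/ 2)) => [||j jn]; [|lia|].
  by rewrite mulnC -modn2 -divn_eq.
rewrite Xc; last by lia.
by rewrite subSS -divnMA -expnS; do 3!f_equal; lia.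
Qed.

Lemma rec_head_bits A X n (f : n.-tuple nat -> nat) : turing_le X A ->
  recursive A f -> recursive A (fun v => head_bits X (f v)).
Proof.
move=> /computable_fromP rX rf.
have := @rec_primrec A n (fun=> 0) (fun k c _ => 2 * c + X k) f (rec_const _ _ _) _ rf.
move=> h; apply: rec_ext (h _) => {h}.
  by move=> v; elim: (f v) => //= k ->.
apply: rec_add; first by rec_tac.
apply: (@rec_comp1 A n.+2 (fun k => nat_of_bool (X k)) _ rX); exact: rec_head.
Qed.

(** If D * (j + 1) ^ d is eventually below 2 ^ j for every D, then so is its
    square at j / 2, which doubles d; start from d = 1. *)
Lemma poly_le_exp C : exists j1, forall j, j1 <= j -> C * j.+1 ^ 4 <= 2 ^ j.
Proof.
have lin C' : exists j1, forall j, j1 <= j -> C' * j.+1 <= 2 ^ j.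
  exists (C' * C' + C').+1 => j h.
  (* With m = j - C' one has 2 ^ j >= (m + 1) (C' + 1), which is large enough
     once m is at least C' * C'. *)
  have le : C' <= j by nia.
  have h1 := ltn_expl (j - C') (isT : 1 < 2); have h2 := ltn_expl C' (isT : 1 < 2).
  rewrite -(subnK le) expnD; apply: leq_trans (leq_mul h1 h2).
  by move: h; rewrite -{1}(subnK le); nia.
have square d C' : 0 < d -> (forall D, exists j1, forall j, j1 <= j -> D * j.+1 ^ d <= 2 ^ j) ->
    exists j1, forall j, j1 <= j -> C' * j.+1 ^ (2 * d) <= 2 ^ j.
  move=> d0 H; have [j1 hj] := H (C' * 2 ^ d); exists (2 * j1).+1 => j h.
  have := hj j./2; rewrite -leq_double.
  have -> : (j1.*2 <= (j./2).*2) by lia.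
  move=> /(_ isT) le.
  have {}le : (C' * 2 ^ d * (j./2).+1 ^ d) ^ 2 <= 2 ^ j.
    apply: (@leq_trans ((2 ^ j./2) ^ 2)); first by rewrite leq_exp2r //.
    by rewrite -expnM leq_exp2l //; lia.
  apply: leq_trans le; rewrite -mulnA -expnMn.
  apply: (@leq_trans (C' * (2 * (j./2).+1) ^ (2 * d))).
    rewrite leq_mul2l leq_exp2r; first by apply/orP; right; lia.
    by rewrite muln_gt0.
  rewrite [2 * d]mulnC expnM; move: (_ ^ d) => P; rewrite expnMn leq_mul2r -mulnn; apply/orP; right.
  by case: (C') => // c; rewrite leq_pmulr.
by apply: (square 2) => // D; apply: (square 1).
Qed.

(** Members of V are codes of prefixes of length n and tau is the code of one of
    length l <= n, so that the division is truncation. *)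
Definition descendants (V : nat -> bool) n l tau :=
  sum_below (2 ^ n) (fun w => V w && (w %/ 2 ^ (n - l) == tau)).

Lemma leq_sum_below h F F' : (forall i, i < h -> F i <= F' i) ->
  sum_below h F <= sum_below h F'.
Proof. by move=> le; apply: leq_sum => i _; apply: le. Qed.

Lemma leq_descendants (V : nat -> bool) n l tau : descendants V n l tau <= sum_below (2 ^ n) V.
Proof. apply: leq_sum_below => i _; by case: (V i) => //; case: (_ == _). Qed.

Lemma descendants_split V n l b s : l + b <= n ->
  sum_below (2 ^ b) (fun z => descendants V n (l + b) (s * 2 ^ b + z))
  = descendants V n l s.
Proof.
move=> lbn; rewrite /descendants /sum_below exchange_big /=; apply: eq_bigr => w _.
have -> : n - l = (n - (l + b)) + b by lia.
rewrite expnD divnMA; set q := (w %/ _).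
case: (V w) => /=; last by rewrite big1.
have B0 : 0 < 2 ^ b by rewrite expn_gt0.
rewrite [in RHS](divn_eq q (2 ^ b)) divnMDl // (divn_small (ltn_pmod _ B0)) addn0.
rewrite (bigD1 (Ordinal (ltn_pmod q B0))) //= big1 => [|z zq].
  by rewrite addn0 {1}(divn_eq q (2 ^ b)) eqn_add2r eqn_pmul2r.
apply/eqP; rewrite eqb0; apply: contra zq => /eqP qe.
by rewrite -val_eqE /= qe modnMDl modn_small.
Qed.

Section ZeroOne.
Variables (a r : nat) (a_gt0 : 0 < a) (r_gt0 : 0 < r).
Local Notation gain := (gain a).
Local Notation out := (out a r).
Local Notation fan := (fan a r).
Local Notation block := (block a r).

Definition total_gain k := sum_below k (fun i => gain i.+1).

(** The closed form of [total_gain_double] then turns all estimates on lengths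
    into polynomial inequalities. *)
Lemma out_total k : out k = r * total_gain k.
Proof. by rewrite /total_gain /sum_below big_distrr. Qed.

Lemma total_gain_double k : 2 * total_gain k = a * k * k.+1 + 6 * k.
Proof.
by rewrite /total_gain; elim: k => [|k]; rewrite ?sum_belowS /gain; [rewrite /sum_below big_ord0|]; nia.
Qed.

Lemma out_mono k l : k <= l -> out k <= out l.
Proof.
rewrite !out_total leq_mul2l => kl; apply/orP; right.
by rewrite -(leq_pmul2l (isT : 0 < 2)) !total_gain_double; nia.
Qed.

Lemma out_ge k : k <= out k.
Proof. by rewrite out_total; have := total_gain_double k; nia. Qed.

(** The last block of tau keeps at least the fraction
    2 ^ - ((r - 1) * gain j.+1) of the members of V that extend the earlier
    blocks. *)
Definition popular V n j tau :=
  (0 < descendants V n (out j.+1) tau) &&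
  (descendants V n (out j) (tau %/ 2 ^ block j.+1)
     <= 2 ^ ((r - 1) * gain j.+1) * descendants V n (out j.+1) tau).

(** Distinct blocks have disjoint sets of descendants, so at most
    2 ^ ((r - 1) * gain j.+1) of them can be popular. *)
Lemma popular_sparse V n j : out j.+1 <= n -> sparse_fibres a r j (popular V n j).
Proof.
move=> jn; apply/all_belowP => s _; set B := 2 ^ block j.+1; set v := 2 ^ _.
have B0 : 0 < B by rewrite expn_gt0.
have sdiv z : z < B -> (s * B + z) %/ B = s by move=> zB; rewrite divnMDl // divn_small ?addn0.
have := @descendants_split V n (out j) (block j.+1) s; rewrite -outS -/B => /(_ jn).
case: (posnP (descendants V n (out j) s)) => [->|D0] sumE.
  rewrite [X in X <= _](_ : _ = 0) //; apply/eqP.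
  move/eqP: sumE; rewrite /sum_below !sum_nat_eq0 => /forallP h; apply/forallP => z.
  by move: (h z); rewrite /popular => /eqP ->.
rewrite -(leq_pmul2r D0) -[X in _ <= _ * X]sumE /sum_below big_distrl big_distrr /=.
apply: leq_sum => z _; case: (boolP (popular V n j _)) => [/andP[_]|_].
  by rewrite sdiv // mul1n.
by rewrite mul0n.
Qed.

(** If no block between levels i0 and k were popular, each would divide the
    number of descendants by more than 2 ^ ((r - 1) * gain j.+1), and none would
    be left at level k, although the given prefix of Z is in V. *)
Lemma popular_exists (V : nat -> bool) n Z i0 k : out k <= n -> V (head_bits Z n) -> i0 <= k ->
  sum_below (2 ^ n) V < 2 ^ ((r - 1) * (total_gain k - total_gain i0)) ->
  exists j, [/\ i0 <= j, j < k & popular V n j (head_bits Z (out j.+1))].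
Proof.
move=> kn VZ ik few; apply: contrapT => none.
have pos j : j <= k -> 0 < descendants V n (out j) (head_bits Z (out j)).
  move=> jk; have jn : out j <= n := leq_trans (out_mono jk) kn.
  rewrite /descendants /sum_below (bigD1 (Ordinal (head_bits_lt Z n))) //= VZ.
  by rewrite -{1}(subnKC jn) head_bits_div eqxx.
have chain d : i0 + d <= k ->
    2 ^ ((r - 1) * (total_gain (i0 + d) - total_gain i0)) *
      descendants V n (out (i0 + d)) (head_bits Z (out (i0 + d)))
    <= descendants V n (out i0) (head_bits Z (out i0)).
  elim: d => [|d IH] dk; first by rewrite addn0 subnn muln0 mul1n.
  move: dk; rewrite addnS => dk; apply: leq_trans (IH (ltnW dk)).
  have mono : total_gain i0 <= total_gain (i0 + d).
    rewrite -(leq_pmul2l (isT : 0 < 2)) !total_gain_double; nia.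
  have -> : total_gain (i0 + d).+1 - total_gain i0
          = (total_gain (i0 + d) - total_gain i0) + gain (i0 + d).+1.
    by rewrite {1}/total_gain sum_belowS -/(total_gain _); lia.
  rewrite mulnDr expnD -mulnA leq_mul2l; apply/orP; right.
  rewrite leqNgt; apply/negP => h; apply: none; exists (i0 + d); split=> //.
    by rewrite leq_addr.
  rewrite /popular pos //= outS head_bits_div; move: h; rewrite outS => h.
  exact: ltnW.
have := chain (k - i0); rewrite subnKC // => /(_ (leqnn _)) le.
have := leq_trans le (leq_descendants _ _ _ _); rewrite leqNgt => /negP[].
apply: leq_trans few _; rewrite leq_pmulr //; exact: pos.
Qed.

(** The exponent (r - 3) * total_gain k.+1 bounds t * out k.+1 when t is at most
    1 - 3 / r.  What is lost by starting at level k / (4 r) and by passing from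
    k to k + 1 is a small fraction of total_gain k, which is quadratic in k;
    the difference between r - 3 and r - 1 pays for it. *)
Lemma few_enough c : 3 <= r -> exists k1, forall k, k1 <= k ->
  c + (r - 3) * total_gain k.+1 < (r - 1) * (total_gain k - total_gain (k %/ (4 * r))).
Proof.
move=> r3; exists (c + 4 * r).+1 => k kc; set i := k %/ _.
have ir : i * (4 * r) <= k by exact: leq_divM.
have tS : total_gain k.+1 = total_gain k + gain k.+1 by exact: sum_belowS.
have ik : i <= k by exact: leq_div.
have Sg : total_gain i <= i * gain k.+1.
  rewrite -(leq_pmul2l (isT : 0 < 2)) total_gain_double /gain; nia.
have Tg : 2 * total_gain k = k * gain k.+1 + 3 * k.
  by rewrite total_gain_double /gain; nia.
rewrite tS; move: (total_gain k) (total_gain i) (gain k.+1) Sg Tg => T S g Sg Tg.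
have [r' rE] : exists r', r = r' + 3 by exists (r - 3); lia.
have -> : r - 3 = r' by lia. have -> : r - 1 = r' + 2 by lia.
(* Each of the two losses is at most a quarter of k * g. *)
have h1 : 4 * ((r' + 2) * S) <= k * g.
  apply: (@leq_trans (i * (4 * r) * g)); last by rewrite leq_mul2r ir orbT.
  have -> : i * (4 * r) * g = 4 * (r * (i * g)) by lia.
  by rewrite leq_mul2l /=; apply: leq_mul => //; lia.
have h2 : 4 * (r' * g) <= k * g.
  by rewrite mulnA leq_mul2r; apply/orP; right; lia.
have h3 : c + r' * g + (r' + 2) * S < 2 * T by lia.
have h4 : (r' + 2) * (T - S) = (r' + 2) * T - (r' + 2) * S by rewrite mulnBr.
rewrite h4 mulnDr mulnDl; lia.
Qed.

Section Cover.
Variables (I : set cantor_seq) (idealI : turing_ideal I) (V : nat -> nat -> bool).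
Hypothesis coverV : forall Z, I Z -> forall N, exists n, N <= n /\ V n (head_bits Z n).
Variable k1 : nat.
Hypothesis fewV : forall k n, k1 <= k -> n < out k.+1 ->
  sum_below (2 ^ n) (V n) < 2 ^ ((r - 1) * (total_gain k - total_gain (k %/ (4 * r)))).

Variable F : nat -> nat -> nat -> nat.
Hypothesis recF : forall A, recursive A
  (fun v : 3.-tuple nat => F (thead v) (thead (tail v)) (thead (tail (tail v)))).
Hypothesis F_lt : forall k x y, F k x y < 2 ^ out k.
Hypothesis F_ext : forall k, extends a r k (F k) (F k.+1).
Hypothesis F_disp : forall k W, sparse_fibres a r k W -> disperses a r k (F k.+1) W.

(** A popular block at level j can come from a member of the cover whose level k
    has k / (4 r) <= j; the lengths n of these members stay below this bound. *)
Definition horizon j := out (4 * r * j.+1).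

(** The prefixes x of the first source to be avoided: for some n there are many
    y that make the new block popular. *)
Definition heavy j x := [exists n : 'I_(horizon j), (out j.+1 <= n) &&
  (fan j.+1 <= sum_below (2 ^ (a * j.+1)) (fun y => popular (V n) n j (F j.+1 x y)))].

(** The prefixes y of the second source to be avoided once x is given. *)
Definition caught x j y := [exists n : 'I_(horizon j), (out j.+1 <= n) &&
  popular (V n) n j (F j.+1 x y) &&
  (sum_below (2 ^ (a * j.+1)) (fun y => popular (V n) n j (F j.+1 x y)) < fan j.+1)].

Definition output X Y k := F k (head_bits X (a * out k)) (head_bits Y (a * k)).

Lemma output_div X Y k l : k <= l -> output X Y l %/ 2 ^ (out l - out k) = output X Y k.
Proof.
move=> /subnKC <-; elim: (l - k) => [|d IH]; first by rewrite addn0 subnn divn1.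
rewrite addnS -IH.
have /all_belowP h := F_ext (k + d).
have {}h := h (head_bits X (a * out (k + d).+1)) (head_bits_lt _ _).
have /all_belowP {}h := h.
have /eqP := h (head_bits Y (a * (k + d).+1)) (head_bits_lt _ _).
rewrite [in head_bits Y _ %/ _]mulnS [a + _]addnC head_bits_div.
rewrite [in head_bits X _ %/ _]outS mulnDr head_bits_div => e.
rewrite [output X Y (k + d)]/output -e -divnMA -expnD; congr (_ %/ 2 ^ _).
by rewrite outS; have := out_mono (leq_addr d k); lia.
Qed.

(** Bit j is read off the output of level j + 1, which has at least j + 1 bits;
    by [output_div] any later level gives the same bit. *)
Definition extract X Y : cantor_seq :=
  fun j => odd (output X Y j.+1 %/ 2 ^ (out j.+1 - j.+1)).

Lemma head_bits_extract X Y k : head_bits (extract X Y) (out k) = output X Y k.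
Proof.
apply: head_bits_bits => [|j jk]; first exact: F_lt.
rewrite /extract; congr odd.
have jo := out_ge j.+1.
case: (leqP k j.+1) => h.
  rewrite -(output_div X Y h) -divnMA -expnD; congr (_ %/ 2 ^ _).
  by have := out_mono h; lia.
rewrite -(output_div X Y (ltnW h)) -divnMA -expnD; congr (_ %/ 2 ^ _).
by have := out_mono (ltnW h); lia.
Qed.

(** The only place where closure under joins is needed in the zero-one law. *)
Lemma extract_ideal X Y : I X -> I Y -> I (extract X Y).
Proof.
move=> IX IY; have [_ down join] := idealI.
apply: down (join _ _ IX IY) _; apply/computable_fromP.
set A := turing_join X Y.
have rX n f : recursive A f -> recursive A (fun v : n.-tuple nat => head_bits X (f v)).
  exact/rec_head_bits/turing_le_joinl.
have rY n f : recursive A f -> recursive A (fun v : n.-tuple nat => head_bits Y (f v)).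
  exact/rec_head_bits/turing_le_joinr.
pose pr (i : 'I_3) (v : 1.-tuple nat) :=
  if i == 0 :> nat then (thead v).+1 else
  if i == 1 :> nat then head_bits X (a * out (thead v).+1) else head_bits Y (a * (thead v).+1).
have rpr i : recursive A (pr i).
  rewrite /pr; case: eqP => _; first by rec_tac.
  case: eqP => _; [apply: rX|apply: rY]; last by rec_tac.
  by rewrite /out /block /gain; rec_tac.
have ro : recursive A (fun v : 1.-tuple nat => output X Y (thead v).+1).
  apply: rec_ext (rec_comp (recF A) rpr) => v.
  rewrite /output; congr F; rewrite ?theadE /thead ?tnth_mktuple //.
    by rewrite tnth_behead tnth_mktuple /pr /= inordK.
  by rewrite !tnth_behead tnth_mktuple /pr /= !inordK.
rewrite /extract.
apply: (@rec_odd A _ (fun v => _ %/ _)).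
by apply: rec_div => //; rewrite /out /block /gain; rec_tac.
Qed.

(** For each of the [horizon j] lengths n the set of popular outputs has sparse
    fibres, so the table disperses it. *)
Lemma heavy_few j : sum_below (2 ^ (a * out j.+1)) (heavy j) <= horizon j * 2 ^ out j.+1.
Proof.
pose P (n : 'I_(horizon j)) x := (out j.+1 <= n) &&
  (fan j.+1 <= sum_below (2 ^ (a * j.+1)) (fun y => popular (V n) n j (F j.+1 x y))).
apply: (@leq_trans (\sum_(n < horizon j) sum_below (2 ^ (a * out j.+1)) (P n))).
  rewrite /sum_below exchange_big; apply: leq_sum => x _.
  rewrite /heavy; case: existsP => // -[n hn].
  by rewrite (bigD1 n) //= /P hn.
rewrite -[X in _ <= X * _]card_ord -sum_nat_const; apply: leq_sum => n _.
case: (leqP (out j.+1) n) => jn; last first.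
  by rewrite /sum_below big1 // => x _; rewrite /P leqNgt jn.
apply: leq_trans (ltnW (F_disp (popular_sparse (V n) jn))).
by apply: leq_sum_below => x _; rewrite /P jn.
Qed.

Lemma caught_few j x :
  sum_below (2 ^ (a * j.+1)) (caught x j) <= horizon j * fan j.+1.
Proof.
pose T (n : 'I_(horizon j)) := sum_below (2 ^ (a * j.+1)) (fun y => popular (V n) n j (F j.+1 x y)).
pose P (n : 'I_(horizon j)) y :=
  (out j.+1 <= n) && popular (V n) n j (F j.+1 x y) && (T n < fan j.+1).
apply: (@leq_trans (\sum_(n < horizon j) sum_below (2 ^ (a * j.+1)) (P n))).
  rewrite /sum_below exchange_big; apply: leq_sum => y _.
  rewrite /caught; case: existsP => // -[n hn].
  by rewrite (bigD1 n) //= /P hn.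
rewrite -[X in _ <= X * _]card_ord -sum_nat_const; apply: leq_sum => n _.
case: (ltnP (T n) (fan j.+1)) => jn; last first.
  by rewrite /sum_below big1 // => y _; rewrite /P ltnNge jn andbF.
apply: leq_trans (ltnW jn); apply: leq_sum_below => y _.
by rewrite /P jn andbT; case: (out j.+1 <= n).
Qed.

(** The prefix of Z = [extract X Y] that lies in the cover has a popular block at
    a late level j, and the value of the table there is the prefix of Z. *)
Lemma heavy_or_caught X Y J : I X -> I Y ->
  exists2 j, J <= j & heavy j (head_bits X (a * out j.+1)) \/
    caught (head_bits X (a * out j.+1)) j (head_bits Y (a * j.+1)).
Proof.
move=> IX IY; set Z := extract X Y.
pose K := maxn k1 (4 * r * J).
have [n [Kn VZ]] := coverV (extract_ideal IX IY) (out K).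
(* The level k of the prefix is the one with out k <= n < out k.+1. *)
have [k [Kk kn nk]] : exists k, [/\ K <= k, out k <= n & n < out k.+1].
  have ex : exists k, n < out k.+1 by exists n; exact: out_ge.
  case: (ex_minnP ex) => k nk kmin; exists k; split=> //.
    by rewrite leqNgt; apply/negP => /out_mono; lia.
  case: k nk kmin => [|k] nk kmin; first by rewrite /out /sum_below big_ord0.
  by rewrite leqNgt; apply/negP => /kmin; rewrite ltnn.
have k1k : k1 <= k by apply: leq_trans Kk; exact: leq_maxl.
have [j [ij jk pop]] := popular_exists kn VZ (leq_div _ _) (fewV k1k nk).
have r4 : 0 < 4 * r by lia.
exists j.
  apply: leq_trans ij; rewrite leq_divRL // mulnC; apply: leq_trans Kk; exact: leq_maxr.
have nh : n < horizon j.
  apply: leq_trans nk _; apply: out_mono.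
  by have := ltn_ceil k r4; move: ij; nia.
have jn : out j.+1 <= n by apply: leq_trans kn; exact: out_mono.
rewrite head_bits_extract in pop.
set x := head_bits X _ in pop *.
case: (leqP (fan j.+1) (sum_below (2 ^ (a * j.+1)) (fun y => popular (V n) n j (F j.+1 x y)))) => h.
  by left; apply/existsP; exists (Ordinal nh); rewrite jn.
by right; apply/existsP; exists (Ordinal nh); rewrite jn h andbT.
Qed.

(** The factor [horizon j] and the factor a * out j.+1 in [fan j.+1] grow
    polynomially, so they cost nothing once the rates 1 / a are doubled. *)
Lemma horizon_small : exists j1, forall j, j1 <= j ->
  horizon j <= 2 ^ out j.+1 /\ horizon j * fan j.+1 <= 2 ^ (2 * j.+1).
Proof.
(* out k is at most r (a + 3) k ^ 2; the constant collects the two factors. *)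
pose C := (r * (a + 3) * 16 * r ^ 2) * (a * r * (a + 3)).
have [j1 hj] := poly_le_exp C; exists j1 => j /hj le.
have outb k : out k <= r * (a + 3) * k ^ 2.
  rewrite out_total -!mulnA leq_mul2l; apply/orP; right.
  rewrite -(leq_pmul2l (isT : 0 < 2)) total_gain_double -mulnn.
  have kk : k <= k * k by nia.
  have akk : a * k <= a * (k * k) by rewrite leq_mul2l kk orbT.
  lia.
have hb : horizon j * (a * out j.+1) <= 2 ^ j.
  apply: leq_trans le.
  apply: (@leq_trans ((r * (a + 3) * (4 * r * j.+1) ^ 2) * (a * (r * (a + 3) * j.+1 ^ 2)))).
    by apply: leq_mul; [exact: outb|rewrite leq_mul2l outb orbT].
  by apply: eq_leq; rewrite /C; ring.
have h1 : 0 < a * out j.+1 by rewrite muln_gt0 a_gt0; exact: leq_trans (out_ge _).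
split.
  apply: leq_trans (leq_pexp2l (isT : 0 < 2) (leq_trans (leqnSn j) (out_ge j.+1))).
  by apply: leq_trans hb; rewrite leq_pmulr.
rewrite /fan mulnA mul2n -addnn expnD leq_mul2r.
by apply/orP; right; apply: leq_trans hb _; rewrite leq_exp2l.
Qed.

End Cover.

End ZeroOne.

(** * The zero-one law for sparse covers *)

Import Order.TTheory GRing.Theory Num.Theory.
Import numFieldNormedType.Exports.
Local Open Scope classical_set_scope.
Local Open Scope ring_scope.


Section Small.
Variable R : realType.

(** The combinatorial form of being Hausdorff null in dimension s: V n is a set
    of prefixes of length n.  One dimension serves for subsets of the Cantor
    space and of the line alike, and the count at each length takes the place of
    a convergent sum of weights. *)
Definition sparsely_covered (s : R) (E : set cantor_seq) : Prop :=
  exists (V : nat -> nat -> bool) (C : R),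
    (forall n, (sum_below (2 ^ n) (V n))%:R <= C * 2 `^ (s * n%:R)) /\
    forall X, E X -> forall N, exists n, (N <= n)%N /\ V n (head_bits X n).

Lemma powR2_nat n : 2 `^ n%:R = (2 ^ n)%:R :> R.
Proof. by rewrite powR_mulrn // natrX. Qed.

(** It is enough to cover along a sequence of lengths a * c j, as no prefixes
    need be used at other lengths; 2 ^ (2 c j) prefixes is rate 2 / a. *)
Lemma sparsely_covered_levels (a : nat) (c : nat -> nat) j1 (S : nat -> nat -> bool) E :
  (0 < a)%N -> {homo c : i j / (i < j)%N} ->
  (forall j, (j1 <= j)%N -> (sum_below (2 ^ (a * c j)) (S j) <= 2 ^ (2 * c j))%N) ->
  (forall X, E X -> forall J, exists2 j, (J <= j)%N & S j (head_bits X (a * c j))) ->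
  sparsely_covered (2 / a%:R) E.
Proof.
move=> a0 cmono few cov.
have cge j : (j <= c j)%N.
  by elim: j => // j IH; apply: leq_ltn_trans IH (cmono _ _ (ltnSn j)).
pose V n x := [exists j : 'I_n.+1, [&& j1 <= j, a * c j == n & S j x]]%N.
exists V, 1; split=> [n|X EX N].
  rewrite mul1r.
  case: (pselect (exists j, (j1 <= j)%N /\ (a * c j)%N = n)) => [[j [jj jn]]|none].
    have -> : 2 / a%:R * n%:R = (2 * c j)%:R :> R.
      rewrite -jn !natrM; field; by rewrite pnatr_eq0 -lt0n.
    rewrite powR2_nat ler_nat; apply: leq_trans (few _ jj); rewrite jn.
    apply: leq_sum_below => x _; rewrite /V.
    case: existsP => // -[j' /and3P[_ /eqP j'n Sx]].
    suff -> : j = j' by rewrite Sx.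
    move/eqP: (etrans j'n (esym jn)); rewrite eqn_pmul2l // => /eqP cj.
    by case: (ltngtP j j') => // /cmono; rewrite cj ltnn.
  rewrite /sum_below big1 ?powR_ge0 // => x _; rewrite /V.
  case: existsP => // -[j /and3P[jj /eqP jn _]].
  by case: none; exists j.
have [j Jj Sj] := cov X EX (maxn N j1).
have jn : (j <= a * c j)%N by apply: leq_trans (cge j) _; rewrite leq_pmull.
exists (a * c j)%N; split.
  by apply: leq_trans jn; apply: leq_trans Jj; exact: leq_maxl.
apply/existsP; exists (Ordinal (jn : (j < (a * c j).+1)%N)) => /=.
by rewrite eqxx Sj (leq_trans (leq_maxr _ _) Jj).
Qed.

(** The sources X and Y are chosen one after the other outside the sets that
    [heavy_few] and [caught_few] bound, which contradicts [heavy_or_caught]. *)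
Theorem sparsely_covered_zero_one I (t : R) a : turing_ideal I -> t < 1 -> sparsely_covered t I ->
  (0 < a)%N -> sparsely_covered (2 / a%:R) I.
Proof.
move=> idI t1 [V [C [Vfew Vcov]]] a0; apply: contrapT => big.
(* The parameter r with t <= 1 - 3 / r. *)
have [r r3 rt] : exists2 r, (3 <= r)%N & t * r%:R <= (r - 3)%:R.
  have [m hm] : exists m : nat, 3 / (1 - t) <= m%:R.
    by exists (Num.truncn (3 / (1 - t))).+1; apply/ltW/truncnS_gt.
  exists (m + 3)%N; first exact: leq_addl.
  have t0 : 0 < 1 - t by rewrite subr_gt0.
  move: hm; rewrite ler_pdivrMr // addnK natrD; nra.
have r0 : (0 < r)%N by lia.
have [c Cc] : exists c : nat, C <= 2 ^+ c.
  exists (Num.truncn C).+1; apply: le_trans (ltW (truncnS_gt _)) _.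
  by rewrite -natrX ler_nat ltnW // ltn_expl.
have [k1 few] := few_enough a0 r0 c r3.
have fewV k n : (k1 <= k)%N -> (n < out a r k.+1)%N ->
    (sum_below (2 ^ n) (V n)
      < 2 ^ ((r - 1) * (total_gain a k - total_gain a (k %/ (4 * r)))))%N.
  move=> /few; rewrite -(ltn_exp2l _ _ (isT : (1 < 2)%N)) => lt nk; apply: leq_ltn_trans lt.
  rewrite -(ler_nat R); apply: le_trans (Vfew n) _.
  rewrite expnD natrM -powR2_nat powR_mulrn // ler_pM //.
  - have := Vfew 0%N; rewrite mulr0 powRr0 mulr1; apply: le_trans; exact: ler0n.
  rewrite -powR2_nat ler_powR ?ler1n // natrM.
  have nk' : n%:R <= r%:R * (total_gain a k.+1)%:R :> R.
    by rewrite -natrM ler_nat -out_total ltnW.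
  have g0 : 0 <= (total_gain a k.+1)%:R :> R by exact: ler0n.
  have n0 : 0 <= n%:R :> R by exact: ler0n.
  have q0 : 0 <= (r - 3)%:R :> R by exact: ler0n.
  case: (lerP 0 t) => t0; last by nra.
  apply: le_trans (ler_wpM2l t0 nk') _; nra.
have [F [recF F_lt F_ext F_disp]] := exists_disperser a0 r0.
have [j1 hj] := horizon_small a0 r0.
have hoc X Y J := @heavy_or_caught a r a0 r0 I idI V Vcov k1 fewV F recF F_lt F_ext X Y J.
have out_homo : {homo (fun j => out a r j.+1) : i j / (i < j)%N}.
  apply: homo_ltn => [|j]; first exact: ltn_trans.
  by rewrite [X in (_ < X)%N]outS /block /gain; nia.
have [X IX [J1 X1]] : exists2 X, I X & exists J, forall j, (J <= j)%N ->
    ~~ heavy a r V F j (head_bits X (a * out a r j.+1)).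
  apply: contrapT => none; apply: big.
  apply: (sparsely_covered_levels (S := heavy a r V F) (j1 := j1) a0 out_homo).
    move=> j /hj[h _]; apply: leq_trans (heavy_few V F_disp j) _.
    by rewrite mul2n -addnn expnD leq_mul2r h orbT.
  move=> X IX J; apply: contrapT => nj; apply: none; exists X => //; exists J => j Jj.
  by apply/negP => hv; apply: nj; exists j.
have [Y IY [J2 Y2]] : exists2 Y, I Y & exists J, forall j, (J <= j)%N ->
    ~~ caught a r V F (head_bits X (a * out a r j.+1)) j (head_bits Y (a * j.+1)).
  apply: contrapT => none; apply: big.
  apply: (sparsely_covered_levels (c := S) (j1 := j1)
    (S := fun j => caught a r V F (head_bits X (a * out a r j.+1)) j) a0).
  - by move=> i j; rewrite ltnS.
  - by move=> j /hj[_ h]; apply: leq_trans h; exact: caught_few.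
  move=> Y IY J; apply: contrapT => nj; apply: none; exists Y => //; exists J => j Jj.
  by apply/negP => hv; apply: nj; exists j.
have [j Jj [hv|ct]] := hoc X Y (maxn J1 J2) IX IY.
  by have := X1 j (leq_trans (leq_maxl _ _) Jj); rewrite hv.
by have := Y2 j (leq_trans (leq_maxr _ _) Jj); rewrite ct.
Qed.

End Small.

(** * Sparse covers give Hausdorff null sets *)

Section Hausdorff.
Variables (R : realType) (T : Type) (d : T -> T -> R).
Hypothesis d_ge0 : forall x y, 0 <= d x y.

Lemma diam_ge0 (U : set T) x : U x -> (0 <= diam d U)%E.
Proof.
move=> Ux; apply: le_trans (ereal_sup_ubound _); last by exists (x, x).
by rewrite /= lee_fin.
Qed.

Lemma diam_le (U : set T) (e : R) :
  (forall x y, U x -> U y -> d x y <= e) -> (diam d U <= e%:E)%E.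
Proof. by move=> h; apply: ge_ereal_sup => _ [[x y] /= [Ux Uy] <-]; rewrite lee_fin h. Qed.

Lemma hausdorff_weight_ge0 s U : (0 <= hausdorff_weight d s U)%E.
Proof. by rewrite /hausdorff_weight; case: asboolP => // _; exact: poweR_ge0. Qed.

Lemma hausdorff_weight_le (s e : R) U : 0 <= s -> 0 <= e ->
  (diam d U <= e%:E)%E -> (hausdorff_weight d s U <= (e `^ s)%:E)%E.
Proof.
move=> s0 e0 Ue; rewrite /hausdorff_weight; case: asboolP => [_|/eqP/set0P[x Ux]].
  by rewrite lee_fin powR_ge0.
have := diam_ge0 Ux; move: Ue; case: (diam d U) => //= D; rewrite !lee_fin => De D0.
by rewrite ge0_ler_powR.
Qed.

Lemma hausdorff_content_ge0 s e E : (0 <= hausdorff_content d s e E)%E.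
Proof.
apply: le_ereal_inf_tmp => _ [U _ <-]; apply: nneseries_ge0 => n _ _.
exact: hausdorff_weight_ge0.
Qed.

(** Being null at every scale is a statement about covers with small total
    weight, in which neither suprema nor infima appear. *)
Lemma hausdorff_measure_eq0P s E :
  hausdorff_measure d s E = 0%E <->
  forall e eta : R, 0 < e -> 0 < eta -> exists U : nat -> set T,
    [/\ E `<=` \bigcup_i U i, forall i, (diam d (U i) <= e%:E)%E &
        (\sum_(0 <= i <oo) hausdorff_weight d s (U i) <= eta%:E)%E].
Proof.
split=> [H0 e eta e0 eta0|H].
  have le : (hausdorff_content d s e E < eta%:E)%E.
    apply: le_lt_trans (_ : 0%E < eta%:E)%E; last by rewrite lte_fin.
    by rewrite -H0; apply: ereal_sup_ubound; exists e.
  have /ereal_inf_lt[_ [U [EU Ue] <-] lt] := le.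
  by exists U; split=> //; exact: ltW.
apply/eqP; rewrite eq_le; apply/andP; split.
  apply: ge_ereal_sup => _ [e e0 <-].
  apply/lee_addgt0Pr => eta eta0; rewrite add0e.
  have [U [EU Ue le]] := H e eta e0 eta0.
  by apply: le_trans le; apply: ereal_inf_lbound; exists U.
apply: le_trans (hausdorff_content_ge0 s 1 E) _.
by apply: ereal_sup_ubound; exists 1 => //=.
Qed.

Lemma nneseries_le (u : nat -> \bar R) b : (forall n, 0 <= u n)%E ->
  (forall M, \sum_(0 <= i < M) u i <= b)%E -> (\sum_(0 <= i <oo) u i <= b)%E.
Proof.
move=> u0 ub; apply: lime_le; first exact: is_cvg_nneseries.
by apply: nearW => M; exact: ub.
Qed.

Lemma geometric_sum (q : R) M : 0 <= q -> q < 1 ->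
  \sum_(0 <= n < M) q ^+ n <= (1 - q)^-1.
Proof.
move=> q0 q1; have p0 : 0 < 1 - q by rewrite subr_gt0.
rewrite -[leRHS]div1r ler_pdivlMr // big_mkord mulrC.
by rewrite -opprB mulNr -subrX1 opprB gerBl exprn_ge0.
Qed.

(** The tail of a limsup cover is a cover, and its total weight is bounded by the
    tail of a geometric series of ratio 2 ^ (s - s'). *)
Lemma hausdorff_measure_limsup_eq0 (s s' C : R) (E : set T) (W : nat -> seq (set T)) :
  0 <= s' -> s < s' ->
  (forall n i x y, nth set0 (W n) i x -> nth set0 (W n) i y -> d x y <= 2 ^- n) ->
  (forall n, (size (W n))%:R <= C * 2 `^ (s * n%:R)) ->
  (forall e, E e -> forall N, exists n, (N <= n)%N /\ exists i, nth set0 (W n) i e) ->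
  hausdorff_measure d s' E = 0%E.
Proof.
move=> s0 ss Wd Wsize cov; apply/hausdorff_measure_eq0P => e eta e0 eta0.
pose q : R := 2 `^ (s - s').
have q0 : 0 <= q by exact: powR_ge0.
have q1 : q < 1 by rewrite /q /powR pnatr_eq0 /= expR_lt1 nmulr_rlt0 ?subr_lt0 // ln_gt0 // ltr1n.
have C0 : 0 <= C.
  by have := Wsize 0%N; rewrite mulr0 powRr0 mulr1; apply: le_trans; exact: ler0n.
have small_pow (z b : R) : 0 <= z -> z < 1 -> 0 < b -> exists N : nat, forall n, (N <= n)%N -> z ^+ n <= b.
  move=> z0 z1 b0; have := @cvg_expr R z; rewrite ger0_norm // => /(_ z1).
  move=> /cvgrPdist_le /(_ b b0) [N _ hN]; exists N => n Nn.
  by have := hN n Nn; rewrite /= sub0r normrN ger0_norm // exprn_ge0.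
have [N1 hN1] : exists N : nat, forall n, (N <= n)%N -> (2^-1 : R) ^+ n <= e.
  by apply: small_pow => //; rewrite ?invr_ge0 // invf_lt1 // ltr1n.
have [N2 hN2] : exists N : nat, forall n, (N <= n)%N -> q ^+ n <= eta * (1 - q) / (C + 1).
  apply: small_pow => //; rewrite divr_gt0 ?mulr_gt0 ?subr_gt0 //.
  by rewrite ltr_pwDr.
(* Beyond N the scales are at most e and the tail of the series at most eta. *)
pose N := maxn N1 N2.
have /card_set_bijP[f fbij] : ([set: nat] #= [set: nat * nat])%card.
  by rewrite card_eq_sym; exact: card_nat2.
pose U k := nth set0 (W ((f k).1 + N)%N) (f k).2.
have Ud n i : (diam d (nth set0 (W n) i) <= (2 ^- n)%:E)%E by apply: diam_le => x y; exact: Wd.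
exists U; split.
- move=> x Ex; have [n [Nn [i Wx]]] := cov x Ex N.
  have [_ _ /(_ ((n - N)%N, i) I)] := fbij; rewrite /= => -[k _ fk].
  by exists k => //; rewrite /U fk /= subnK.
- move=> k; apply: le_trans (Ud _ _) _; rewrite lee_fin -exprVn; apply: hN1.
  by apply: leq_trans (leq_addl _ _); exact: leq_maxl.
have w0 p : (0 <= hausdorff_weight d s' (nth set0 (W (p.1 + N)%N) p.2))%E.
  exact: hausdorff_weight_ge0.
rewrite nneseries_esumT; last by move=> k; exact: hausdorff_weight_ge0.
rewrite -(reindex_esum setT setT f (fun p => hausdorff_weight d s' (nth set0 (W (p.1 + N)%N) p.2))) //.
rewrite (_ : [set: nat * nat] = setT `*`` (fun=> setT)); last first.
  by apply/seteqP; split.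
rewrite -(@esum_esum R _ _ setT (fun=> setT) (fun n i => hausdorff_weight d s' (nth set0 (W (n + N)%N) i))) //; last first.
  by move=> *; exact: hausdorff_weight_ge0.
rewrite -nneseries_esumT; last first.
  by move=> n; apply: esum_ge0 => *; exact: hausdorff_weight_ge0.
have level n : (\esum_(i in [set: nat]) hausdorff_weight d s' (nth set0 (W n) i) <= (C * q ^+ n)%:E)%E.
  rewrite -nneseries_esumT; last by move=> i; exact: hausdorff_weight_ge0.
  have w1 i : (hausdorff_weight d s' (nth set0 (W n) i) <=
      (if (i < size (W n))%N then 2 `^ (- s' * n%:R) else 0)%:E)%E.
    case: ifPn => [_|]; last first.
      rewrite -leqNgt => /(nth_default set0) ->.
      by rewrite /hausdorff_weight asboolT.
    apply: le_trans (hausdorff_weight_le s0 _ (Ud n i)) _ => //.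
    by rewrite lee_fin -powR_invn // -powRrM mulrC mulrN mulNr.
  apply: nneseries_le => [i|M]; first exact: hausdorff_weight_ge0.
  apply: (@le_trans _ _ (\sum_(0 <= i < M) (if (i < size (W n))%N then 2 `^ (- s' * n%:R) else 0)%:E)%E).
    by apply: lee_sum.
  rewrite sumEFin lee_fin big_mkord.
  apply: (@le_trans _ _ ((minn M (size (W n)))%:R * 2 `^ (- s' * n%:R))).
    elim: M => [|M IH]; first by rewrite big_ord0 min0n mul0r.
    rewrite big_ord_recr /=; apply: le_trans (lerD IH (lexx _)) _.
    case: ifPn => h; last by rewrite addr0 ler_wpM2r ?powR_ge0 // ler_nat; lia.
    by rewrite -[X in _ + X]mul1r -mulrDl ler_wpM2r ?powR_ge0 // natr1 ler_nat; lia.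
  apply: (@le_trans _ _ ((size (W n))%:R * 2 `^ (- s' * n%:R))).
    by rewrite ler_wpM2r ?powR_ge0 // ler_nat geq_minr.
  apply: le_trans (ler_wpM2r (powR_ge0 _ _) (Wsize n)) _.
  rewrite -mulrA -powRD ?pnatr_eq0 ?implybT // -mulrDl.
  by rewrite powRrM powR_mulrn ?powR_ge0.
apply: nneseries_le => [n|M].
  by apply: esum_ge0 => *; exact: hausdorff_weight_ge0.
apply: (@le_trans _ _ (\sum_(0 <= n < M) (C * q ^+ (n + N))%:E)%E).
  by apply: lee_sum => n _; exact: level.
rewrite sumEFin lee_fin -mulr_sumr.
under eq_bigr do rewrite exprD.
rewrite -mulr_suml.
have p0 : 0 < 1 - q by rewrite subr_gt0.
have h1 := geometric_sum M q0 q1.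
have h2 : q ^+ N <= eta * (1 - q) / (C + 1) by apply: hN2; exact: leq_maxr.
apply: (@le_trans _ _ (C * ((1 - q)^-1 * (eta * (1 - q) / (C + 1))))).
  by rewrite ler_wpM2l // ler_pM ?exprn_ge0 // sumr_ge0 // => *; exact: exprn_ge0.
have C1 : 0 < C + 1 by rewrite ltr_pwDr.
have -> : C * ((1 - q)^-1 * (eta * (1 - q) / (C + 1))) = eta * (C / (C + 1)).
  by field; rewrite !gt_eqF.
by rewrite ler_piMr ?(ltW eta0) // ler_pdivrMr // mul1r lerDl.
Qed.

End Hausdorff.

(** * Hausdorff null sets give sparse covers *)

Section SmallOfNull.
Variables (R : realType) (T : Type) (d : T -> T -> R).
Hypothesis d_ge0 : forall x y, 0 <= d x y.

(** A set of diameter D is assigned the scale 2 ^ - n just above D, which changes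
    the weight by the factor 2 ^ s at most.  A set of diameter 0 has no such
    scale; it gets one at which 2 ^ (- s n) is below b, unless s = 0, when all
    weights are 1. *)
Lemma dyadic_scale (s : R) (U : set T) j (b : R) : 0 <= s -> 0 < b ->
  (diam d U <= (2 ^- j)%:E)%E -> exists n, [/\ (j <= n)%N,
    forall x y, U x -> U y -> d x y <= 2 ^- n &
    U !=set0 -> 2 `^ (- s * n%:R) <= 2 `^ s * fine (hausdorff_weight d s U) + b].
Proof.
move=> s0 b0 Uj.
case: (pselect (U !=set0)) => [[u Uu]|U0]; last first.
  by exists j; split=> // x y Ux; case: U0; exists x.
have := diam_ge0 d_ge0 Uu; case DE: (diam d U) Uj => [D| |] //; rewrite !lee_fin => Dj D0.
have dD x y : U x -> U y -> d x y <= D.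
  move=> Ux Uy; rewrite -lee_fin -DE; apply: ereal_sup_ubound.
  by exists (x, y).
have wE : fine (hausdorff_weight d s U) = D `^ s.
  by rewrite /hausdorff_weight asboolF ?DE //; apply/eqP/set0P; exists u.
rewrite wE; case: (ltgtP D 0) D0 => // [Dpos|D0] _.
  have ex : exists m : nat, 2 ^- m < D.
    have := @cvg_expr R 2^-1; rewrite ger0_norm ?invr_ge0 // invf_lt1 // ltr1n => /(_ isT).
    move=> /cvgrPdist_lt /(_ D Dpos) [m _ hm]; exists m.
    by have := hm m (leqnn m); rewrite /= sub0r normrN exprVn ger0_norm // invr_ge0 exprn_ge0.
  case: (ex_minnP ex) => -[|n] mD mmin.
    have : (1 : R) < D by rewrite expr0 invr1 in mD.
    have : 2 ^- j <= (1 : R) by rewrite invf_le1 ?exprn_gt0 // exprn_ege1 // ler1n.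
    lra.
  have Dn : D <= 2 ^- n by rewrite leNgt; apply/negP => /mmin; rewrite ltnn.
  exists n; split=> [|x y Ux Uy|_]; last 2 first.
  - exact: le_trans (dD _ _ Ux Uy) Dn.
  - rewrite ler_wpDr ?(ltW b0) //.
    apply: (@le_trans _ _ (2 `^ s * (2 ^- n.+1) `^ s)); last first.
      by rewrite ler_wpM2l ?powR_ge0 // ge0_ler_powR ?nnegrE ?(ltW mD) ?(ltW Dpos) // invr_ge0 exprn_ge0.
    rewrite -powR_invn // -powRrM -powRD ?pnatr_eq0 ?implybT // ler_powR ?ler1n //.
    by rewrite -natr1; lra.
  have : 2 ^- n.+1 < 2 ^- j :> R by exact: lt_le_trans mD Dj.
  by rewrite ltf_pV2 ?posrE ?exprn_gt0 // ltr_eXn2l ?ltr1n // ltnS.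
have [->|sn0] := eqVneq s 0.
  exists j; split=> // [x y Ux Uy|_].
    by apply: le_trans (dD _ _ Ux Uy) _; rewrite D0 invr_ge0 exprn_ge0.
  by rewrite oppr0 mul0r !powRr0 mul1r lerDl ltW.
have sp : 0 < s by rewrite lt_def sn0.
have q1 : 2 `^ (- s) < 1 :> R.
  by rewrite /powR pnatr_eq0 /= expR_lt1 nmulr_rlt0 ?oppr_lt0 // ln_gt0 // ltr1n.
have := @cvg_expr R (2 `^ (- s)); rewrite ger0_norm ?powR_ge0 // => /(_ q1).
move=> /cvgrPdist_lt /(_ b b0) [m _ hm]; exists (maxn j m); split.
- exact: leq_maxl.
- by move=> x y Ux Uy; apply: le_trans (dD _ _ Ux Uy) _; rewrite D0 invr_ge0 exprn_ge0.
move=> _; rewrite ler_wpDl ?mulr_ge0 ?powR_ge0 //.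
have := hm (maxn j m) (leq_maxr _ _).
rewrite /= sub0r normrN ger0_norm ?exprn_ge0 ?powR_ge0 // => /ltW.
by rewrite powRrM powR_mulrn ?powR_ge0.
Qed.

Lemma sum_injective_le (X Q : finType) (A : {set X}) (g : X -> Q) (h : Q -> R) :
  {in A &, injective g} -> (forall q, 0 <= h q) ->
  \sum_(x in A) h (g x) <= \sum_q h q.
Proof.
move=> ginj h0; rewrite -(big_imset h ginj) /= [leLHS]big_mkcond.
by apply: ler_sum => q _; case: ifP.
Qed.

(** Take a cover of weight at most 2 ^ - j for each j, and put a prefix of length
    n into V n if its cylinder meets a member of scale n.  Every member accounts
    for at most three prefixes, so the number of prefixes of length n is bounded
    by a multiple of 2 ^ (s n) times the sum of the weights of all these covers. *)
Lemma sparsely_covered_of_null (phi : cantor_seq -> T) (s : R) (I : set cantor_seq) (E : set T) :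
  0 <= s -> (forall X, I X -> E (phi X)) ->
  (forall X Y n, d (phi X) (phi Y) <= 2 ^- n -> (head_bits X n <= head_bits Y n + 2)%N) ->
  hausdorff_measure d s E = 0%E -> sparsely_covered s I.
Proof.
move=> s0 IE close /hausdorff_measure_eq0P null.
have pow0 j : 0 < 2 ^- j :> R by rewrite invr_gt0 exprn_gt0.
have [U HU] := choice (fun j => null (2 ^- j) (2 ^- j) (pow0 j) (pow0 j)).
have ex j i := dyadic_scale (b := 2 ^- (i + j)) s0 (pow0 (i + j)%N) (let: And3 _ h _ := HU j in h i).
have [nu Hnu] := choice (fun p : nat * nat => ex p.1 p.2).
pose hit j i n x := nu (j, i) = n /\ exists2 X, I X & U j i (phi X) /\ head_bits X n = x.
pose w j i := fine (hausdorff_weight d s (U j i)).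
have wle j i : hausdorff_weight d s (U j i) = (w j i)%:E.
  rewrite /w fineK // ge0_fin_numE; last exact: hausdorff_weight_ge0.
  have [_ /(_ i) Ud _] := HU j.
  by apply: le_lt_trans (hausdorff_weight_le d_ge0 s0 (ltW (pow0 j)) Ud) _; rewrite ltry.
have w0 j i : 0 <= w j i by apply: fine_ge0; exact: hausdorff_weight_ge0.
(* Two bounds by 2 for geometric series of ratio 1 / 2, and 3 for the number
   of prefixes per member. *)
exists (fun n x => `[< exists j i, hit j i n x >]), (3 * (2 * (2 `^ s + 2))).
split=> [n|X IX N]; last first.
  have [cov _ _] := HU N; have [i _ Ui] := cov _ (IE _ IX).
  have [Nn _ _] := Hnu (N, i); exists (nu (N, i)); split => //.
  by apply/asboolP; exists N, i; split=> //; exists X.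
rewrite sum_below_card; set A := [set x : 'I_(2 ^ n) | _]%SET.
have /choice[g gP] (x : 'I_(2 ^ n)) : exists p : nat * nat, x \in A -> hit p.1 p.2 n x.
  case: (boolP (x \in A)) => [|_]; last by exists (0, 0)%N.
  by rewrite inE => /asboolP[j [i h]]; exists (j, i).
pose B := (\max_(x < 2 ^ n) maxn (g x).1 (g x).2).+1.
have gB x : ((g x).1 < B)%N /\ ((g x).2 < B)%N.
  have : (maxn (g x).1 (g x).2 < B)%N by rewrite ltnS /B; exact: (leq_bigmax x).
  by rewrite gtn_max => /andP[].
(* The remainder modulo 3 separates the prefixes that share a member. *)
pose g' x : 'I_B * 'I_B * 'I_3 :=
  (Ordinal (gB x).1, Ordinal (gB x).2, Ordinal (ltn_pmod x (isT : (0 < 3)%N))).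
have ginj : {in A &, injective g'}.
  move=> x y xA yA [] e1 e2 e3.
  have := gP y yA; have := gP x xA; rewrite e1 e2.
  move=> [nx [X IX [UX Xx]]] [_ [Y IY [UY Yy]]]; apply: val_inj => /=.
  have [_ dU _] := Hnu ((g y).1, (g y).2).
  rewrite nx /= in dU.
  have := close Y X n (dU _ _ UY UX); have := close X Y n (dU _ _ UX UY); rewrite Xx Yy.
  by move: e3 => /=; lia.
pose h (q : 'I_B * 'I_B * 'I_3) : R := 2 `^ s * w q.1.1 q.1.2 + 2 ^- (q.1.2 + q.1.1).
have h0 q : 0 <= h q by rewrite addr_ge0 ?mulr_ge0 ?powR_ge0 // ltW.
have half i : 2 ^- i = (2^-1) ^+ i :> R by rewrite exprVn.
have half_sum M : \sum_(i < M) 2 ^- i <= 2 :> R.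
  under eq_bigr do rewrite half.
  rewrite -(big_mkord xpredT (fun i => (2^-1 : R) ^+ i)).
  have h2 : 0 <= 2^-1 :> R by rewrite invr_ge0.
  have h3 : 2^-1 < 1 :> R by rewrite invf_lt1 // ltr1n.
  by apply: le_trans (geometric_sum M h2 h3) _; rewrite le_eqVlt; apply/orP; left; apply/eqP; field.
have level (j : 'I_B) : \sum_(i < B) (2 `^ s * w j i + 2 ^- (i + j)) <= (2 `^ s + 2) * 2 ^- j.
  rewrite big_split /= -mulr_sumr mulrDl lerD // ?ler_wpM2l ?powR_ge0 //.
    have [_ _ sumU] := HU j; rewrite -lee_fin; apply: le_trans sumU.
    apply: le_trans (nneseries_lim_ge B _); last first.
      by move=> *; exact: hausdorff_weight_ge0.
    rewrite big_mkord -sumEFin le_eqVlt; apply/orP; left; apply/eqP.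
    by apply: eq_bigr => i _; rewrite wle.
  under eq_bigr do rewrite exprD invfM.
  rewrite -mulr_suml; apply: ler_wpM2r; [exact: ltW|exact: half_sum].
have total : \sum_q h q <= 3 * (2 * (2 `^ s + 2)).
  rewrite -(pair_bigA _ (fun p c => h (p, c))) /=.
  under eq_bigr => p _ do rewrite /h /= sumr_const card_ord -(mulr_natl (_ + _)).
  rewrite -mulr_sumr ler_wpM2l //.
  rewrite -(pair_bigA _ (fun j i : 'I_B => 2 `^ s * w j i + 2 ^- (i + j))) /=.
  apply: (@le_trans _ _ (\sum_(j < B) (2 `^ s + 2) * 2 ^- j)); first exact: ler_sum.
  rewrite -mulr_sumr mulrC; apply: ler_wpM2r; last exact: half_sum.
  by rewrite addr_ge0 // powR_ge0.
have : \sum_(x in A) 2 `^ (- s * n%:R) <= \sum_(x in A) h (g' x).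
  apply: ler_sum => x xA; have [nx [X IX [UX _]]] := gP x xA.
  have [_ _ le] := Hnu ((g x).1, (g x).2); rewrite -nx.
  by apply: le; exists (phi X).
move=> /le_trans /(_ (sum_injective_le ginj h0)) /le_trans /(_ total).
rewrite sumr_const -(mulr_natl (_ `^ _)) mulNr powRN => le.
by move: le; rewrite ler_pdivrMr // powR_gt0.
Qed.

End SmallOfNull.

(** * Computable families of reals *)

Lemma rec_app A n (P : nat -> 1.-tuple nat -> nat) (f g : n.-tuple nat -> nat) :
  recursive A (fun w => P (thead w) (tail w)) -> recursive A f -> recursive A g ->
  recursive A (fun v => P (f v) [tuple g v]).
Proof.
move=> rP rf rg.
pose pr (i : 'I_2) (v : n.-tuple nat) := if i == ord0 then f v else g v.
have rpr i : recursive A (pr i) by rewrite /pr; case: eqP.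
apply: rec_ext (rec_comp rP rpr) => v.
have -> : [tuple pr i v | i < 2] = [tuple of f v :: [tuple g v]].
  by apply: eq_from_tnth => i; rewrite tnth_mktuple /pr; case: i => -[|[|//]] ?.
by rewrite theadE tail_cons.
Qed.

(** Used to ask for approximations of a better precision. *)
Lemma rec_reindex A n (P : nat -> n.-tuple nat -> nat) (f : nat -> n.-tuple nat -> nat) :
  recursive A (fun w => P (thead w) (tail w)) ->
  recursive A (fun w => f (thead w) (tail w)) ->
  recursive A (fun w => P (f (thead w) (tail w)) (tail w)).
Proof.
move=> rP rf.
pose pr (i : 'I_n.+1) (w : n.+1.-tuple nat) :=
  if unlift ord0 i is Some j then tnth (tail w) j else f (thead w) (tail w).
have rpr i : recursive A (pr i).
  by rewrite /pr; case: unlift => [j|//]; exact: rec_tail (rec_proj A j).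
apply: rec_ext (rec_comp rP rpr) => w.
have -> : [tuple pr i w | i < n.+1] = [tuple of f (thead w) (tail w) :: tail w].
  apply: eq_from_tnth => i; rewrite tnth_mktuple /pr.
  by case: unliftP => [j ->|->] //; rewrite tnthS.
by rewrite theadE tail_cons.
Qed.

Section Family.
Variable R : realType.
Implicit Type A : cantor_seq.

Definition signed_quotient (P M D : nat) : R := (P%:R - M%:R) / D%:R.

(** Uniformly computable reals.  Approximations are quotients of differences of
    natural numbers, and the precision 1 / (k + 1) is linear in k, so that the
    ring operations need neither signs nor roundings. *)
Definition computable_family A n (g : n.-tuple nat -> R) : Prop :=
  exists P M D : nat -> n.-tuple nat -> nat,
    [/\ recursive A (fun w => P (thead w) (tail w)),
        recursive A (fun w => M (thead w) (tail w)),
        recursive A (fun w => D (thead w) (tail w)) &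
        forall k v, (0 < D k v)%N /\
          `|g v - signed_quotient (P k v) (M k v) (D k v)| <= k.+1%:R^-1].

Lemma family_ext A n (f g : n.-tuple nat -> R) : f =1 g ->
  computable_family A f -> computable_family A g.
Proof.
move=> fg [P [M [D [rP rM rD H]]]]; exists P, M, D; split=> // k v.
by rewrite -fg.
Qed.

Lemma family_nat A n (f : n.-tuple nat -> nat) : recursive A f ->
  computable_family A (fun v => (f v)%:R).
Proof.
move=> rf; exists (fun _ v => f v), (fun _ _ => 0%N), (fun _ _ => 1%N); split.
- exact: rec_tail rf.
- exact: rec_const.
- exact: rec_const.
by move=> k v; split=> //; rewrite /signed_quotient subr0 divr1 subrr normr0.
Qed.

Lemma family_inv_nat A n (f : n.-tuple nat -> nat) : recursive A f ->
  (forall v, 0 < f v)%N -> computable_family A (fun v => (f v)%:R^-1).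
Proof.
move=> rf f0; exists (fun _ _ => 1%N), (fun _ _ => 0%N), (fun _ v => f v); split.
- exact: rec_const.
- exact: rec_const.
- exact: rec_tail rf.
by move=> k v; split=> //; rewrite /signed_quotient subr0 div1r subrr normr0.
Qed.

Lemma family_opp A n (g : n.-tuple nat -> R) : computable_family A g ->
  computable_family A (fun v => - g v).
Proof.
move=> [P [M [D [rP rM rD H]]]]; exists M, P, D; split=> // k v.
have [D0 le] := H k v; split=> //.
rewrite (_ : - g v - _ = - (g v - signed_quotient (P k v) (M k v) (D k v))) ?normrN //.
by rewrite /signed_quotient; ring.
Qed.

Lemma signed_quotientD P M D P' M' D' : (0 < D)%N -> (0 < D')%N ->
  signed_quotient P M D + signed_quotient P' M' D'
  = signed_quotient (P * D' + P' * D) (M * D' + M' * D) (D * D').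
Proof.
move=> D0 D'0; rewrite /signed_quotient !natrD !natrM; field.
by rewrite !pnatr_eq0 -!lt0n D0 D'0.
Qed.

Lemma signed_quotientM P M D P' M' D' :
  signed_quotient P M D * signed_quotient P' M' D'
  = signed_quotient (P * P' + M * M') (P * M' + M * P') (D * D').
Proof. by rewrite /signed_quotient !natrD !natrM invfM; ring. Qed.

Lemma family_add A n (f g : n.-tuple nat -> R) : computable_family A f ->
  computable_family A g -> computable_family A (fun v => f v + g v).
Proof.
move=> [P [M [D [rP rM rD H]]]] [P' [M' [D' [rP' rM' rD' H']]]].
pose t (k : nat) (v : n.-tuple nat) := (2 * k + 1)%N.
have rt : recursive A (fun w : n.+1.-tuple nat => t (thead w) (tail w)) by rewrite /t; rec_tac.
have {}rP := rec_reindex rP rt; have {}rM := rec_reindex rM rt; have {}rD := rec_reindex rD rt.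
have {}rP' := rec_reindex rP' rt; have {}rM' := rec_reindex rM' rt; have {}rD' := rec_reindex rD' rt.
exists (fun k v => P (t k v) v * D' (t k v) v + P' (t k v) v * D (t k v) v)%N,
  (fun k v => M (t k v) v * D' (t k v) v + M' (t k v) v * D (t k v) v)%N,
  (fun k v => D (t k v) v * D' (t k v) v)%N; split.
- exact: rec_add (rec_mul rP rD') (rec_mul rP' rD).
- exact: rec_add (rec_mul rM rD') (rec_mul rM' rD).
- exact: rec_mul rD rD'.
move=> k v; have [D0 le] := H (t k v) v; have [D'0 le'] := H' (t k v) v.
split; first by rewrite muln_gt0 D0.
rewrite -signed_quotientD // opprD addrACA; apply: le_trans (ler_normD _ _) _.
apply: le_trans (lerD le le') _.
have -> : (t k v).+1 = (2 * k.+1)%N by rewrite /t; lia.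
rewrite natrM le_eqVlt; apply/orP; left; apply/eqP; field.
by rewrite nat1r pnatr_eq0.
Qed.

(** The precision needed for the factors depends on bounds of the factors, which
    are themselves computed. *)
Lemma family_mul A n (f g : n.-tuple nat -> R) : computable_family A f ->
  computable_family A g -> computable_family A (fun v => f v * g v).
Proof.
move=> [P [M [D [rP rM rD H]]]] [P' [M' [D' [rP' rM' rD' H']]]].
  (* Integer bounds on f and g, read off their approximations of precision 1. *)
pose B v := (P 0 v + M 0 v + 1)%N; pose B' v := (P' 0 v + M' 0 v + 1)%N.
have bound (h : n.-tuple nat -> R) p m q v : (0 < q)%N ->
    `|h v - signed_quotient p m q| <= 1%:R^-1 -> `|h v| <= (p + m + 1)%N%:R.
  move=> q0; rewrite invr1 => le; rewrite -[h v](subrK (signed_quotient p m q)).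
  apply: le_trans (ler_normD _ _) _; rewrite addrC 2!natrD lerD //.
  rewrite /signed_quotient normrM normfV ler_pdivrMr ?normr_gt0 ?pnatr_eq0 -?lt0n // [`|q%:R|]ger0_norm //.
  apply: (@le_trans _ _ ((p%:R + m%:R) * 1)).
    by rewrite mulr1; apply: le_trans (ler_normB _ _) _; rewrite !ger0_norm.
  by rewrite ler_wpM2l ?addr_ge0 // ler1n.
pose t (k : nat) v := (k.+1 * (B v + B' v + 1))%N.
have r0 (Q : nat -> n.-tuple nat -> nat) : recursive A (fun w => Q (thead w) (tail w)) ->
    recursive A (fun w => Q 0%N (tail w)).
  by move=> rQ; apply: (@rec_reindex A n Q (fun _ _ => 0%N)); last exact: rec_const.
have rB : recursive A (fun w => B (tail w)).
  by apply: rec_add (rec_const _ _ _); apply: rec_add; exact: r0.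
have rB' : recursive A (fun w => B' (tail w)).
  by apply: rec_add (rec_const _ _ _); apply: rec_add; exact: r0.
have rt : recursive A (fun w : n.+1.-tuple nat => t (thead w) (tail w)).
  apply: rec_mul; first by rec_tac.
  exact: rec_add (rec_add rB rB') (rec_const _ _ _).
have fB v : `|f v| <= (B v)%:R by have [q0 le] := H 0 v; exact: bound le.
have gB v : `|g v| <= (B' v)%:R by have [q0 le] := H' 0 v; exact: bound le.
have {}rP := rec_reindex rP rt; have {}rM := rec_reindex rM rt; have {}rD := rec_reindex rD rt.
have {}rP' := rec_reindex rP' rt; have {}rM' := rec_reindex rM' rt; have {}rD' := rec_reindex rD' rt.
exists (fun k v => P (t k v) v * P' (t k v) v + M (t k v) v * M' (t k v) v)%N,
  (fun k v => P (t k v) v * M' (t k v) v + M (t k v) v * P' (t k v) v)%N,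
  (fun k v => D (t k v) v * D' (t k v) v)%N; split.
- exact: rec_add (rec_mul rP rP') (rec_mul rM rM').
- exact: rec_add (rec_mul rP rM') (rec_mul rM rP').
- exact: rec_mul rD rD'.
move=> k v; have [D0 le] := H (t k v) v; have [D'0 le'] := H' (t k v) v.
split; first by rewrite muln_gt0 D0.
rewrite -signed_quotientM; move: le le'; set a := signed_quotient _ _ _; set b := signed_quotient _ _ _ => le le'.
(* The error of the product in terms of the errors of the factors. *)
have -> : f v * g v - a * b = (f v - a) * g v + f v * (g v - b) - (f v - a) * (g v - b) by ring.
have t1 : (t k v).+1%:R^-1 <= 1 :> R by rewrite invf_le1 // ler1n.
apply: le_trans (ler_normB _ _) _; apply: le_trans (lerD (ler_normD _ _) (lexx _)) _.
rewrite !normrM.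
have [e0 h0] : 0 < (t k v).+1%:R^-1 :> R /\
   (t k v).+1%:R^-1 * ((B v)%:R + (B' v)%:R + 1) <= k.+1%:R^-1 :> R.
  split; first by rewrite invr_gt0.
  have -> : (B v)%:R + (B' v)%:R + 1 = (B v + B' v + 1)%N%:R :> R by rewrite !natrD.
  rewrite mulrC ler_pdivrMr // mulrC ler_pdivlMr // -natrM ler_nat.
  by rewrite /t; lia.
apply: le_trans h0; move: (fB v) (gB v) le le' t1 e0.
set e := _^-1; set x := `|f v|; set y := `|g v|.
set dx := `|f v - a|; set dy := `|g v - b|.
move=> hx hy hdx hdy e1 e0.
have x0 : 0 <= x by exact: normr_ge0.
have y0 : 0 <= y by exact: normr_ge0.
have dx0 : 0 <= dx by exact: normr_ge0.
have dy0 : 0 <= dy by exact: normr_ge0.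
have i1 : dx * y <= e * (B' v)%:R by rewrite ler_pM.
have i2 : x * dy <= (B v)%:R * e by rewrite ler_pM.
have i3 : dx * dy <= e * 1 by rewrite ler_pM // (le_trans hdy).
by rewrite !mulrDr [e * (B v)%:R]mulrC; lra.
Qed.

Lemma family_rat A n (q : rat) : computable_family A (fun _ : n.-tuple nat => ratr q : R).
Proof.
have rint (z : int) : computable_family A (fun _ : n.-tuple nat => z%:~R : R).
  case: z => m; first exact: (family_nat (rec_const _ _ m)).
  apply: family_ext (family_opp (family_nat (rec_const _ _ m.+1))) => v.
  by rewrite NegzE mulrNz.
have := family_mul (rint (numq q)) (family_inv_nat (f := fun=> `|denq q|%N) (rec_const _ _ _) _).
move=> h; apply: family_ext (h _) => [v|v]; last by rewrite absz_gt0 denq_neq0.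
by rewrite /ratr; congr (_ / _); rewrite -[denq q in RHS]gez0_abs ?denq_ge0.
Qed.

Lemma family_turing_le A B n (g : n.-tuple nat -> R) : turing_le A B ->
  computable_family A g -> computable_family B g.
Proof.
move=> AB [P [M [D [rP rM rD H]]]]; exists P, M, D.
by split=> //; exact: recursive_turing_le AB _.
Qed.

Lemma inv2_le k : 2 ^- k <= k.+1%:R^-1 :> R.
Proof.
by rewrite lef_pV2 ?posrE ?exprn_gt0 // -natrX ler_nat ltn_expl.
Qed.

Lemma computable_realP A x :
  computable_reals R A x <-> computable_family A (fun _ : 1.-tuple nat => x).
Proof.
split=> [[q [[s [a [b [/computable_fromP rs /computable_fromP ra /computable_fromP rb qE]]]] qx]]|].
  have rh (f : nat -> nat) : recursive A (fun v : 1.-tuple nat => f (thead v)) ->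
    recursive A (fun w : 2.-tuple nat => f (thead w)) by move=> rf; apply: rec_comp1 rf (rec_head _ _).
  exists (fun k _ => a k * ~~ odd (s k))%N, (fun k _ => a k * odd (s k))%N, (fun k _ => b k).
  split.
  - exact: rec_mul (rh _ ra) (rec_neg (rec_odd (rh _ rs))).
  - exact: rec_mul (rh _ ra) (rec_odd (rh _ rs)).
  - exact: rh _ rb.
  move=> k v; have [b0 qk] := qE k; split=> //; apply: le_trans (inv2_le k).
  apply: le_trans (qx k); rewrite le_eqVlt; apply/orP; left; apply/eqP.
  congr `|_ - _|; rewrite qk rmorphM fmorph_div /= !ratr_nat rmorphXn rmorphN1 /=.
  rewrite /signed_quotient mulrA -signr_odd; case: odd => /=; rewrite ?muln0 ?muln1; ring.
move=> [P [M [D [rP rM rD H]]]].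
have app (Q : nat -> 1.-tuple nat -> nat) : recursive A (fun w => Q (thead w) (tail w)) ->
    recursive A (fun v : 1.-tuple nat => Q (2 ^ thead v)%N [tuple 0%N]).
  by move=> rQ; apply: rec_app rQ _ _; rec_tac.
move/app: rP => rP; move/app: rM => rM; move/app: rD => rD.
pose p k := P (2 ^ k)%N [tuple 0%N]; pose m k := M (2 ^ k)%N [tuple 0%N].
pose e k := D (2 ^ k)%N [tuple 0%N].
have sE k : (-1) ^+ (p k < m k)%N * (((p k - m k) + (m k - p k))%N%:R / (e k)%:R)
    = signed_quotient (p k) (m k) (e k) :> R.
  rewrite /signed_quotient mulrA; congr (_ / _); case: (ltnP (p k) (m k)) => h.
    by rewrite expr1 (eqP (ltnW h : p k - m k == 0)%N) add0n natrB 1?ltnW // mulN1r opprB.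
  by rewrite expr0 (eqP (h : m k - p k == 0)%N) addn0 natrB // mul1r.
exists (fun k => (-1) ^+ (p k < m k)%N * (((p k - m k) + (m k - p k))%N%:R / (e k)%:R)); split.
  exists (fun k => nat_of_bool (p k < m k)%N), (fun k => (p k - m k) + (m k - p k))%N, e.
  split; [| | |by move=> k; have [] := H (2 ^ k)%N [tuple 0%N]]; apply/computable_fromP.
  - by apply: rec_ext (rec_leq (rec_succ rP) rM) => v.
  - by apply: rec_ext (rec_add (rec_sub rP rM) (rec_sub rM rP)) => v.
  - exact: rD.
move=> k; rewrite rmorphM fmorph_div /= !ratr_nat rmorphXn rmorphN1 /= sE.
have [_ le] := H (2 ^ k)%N [tuple 0%N]; apply: le_trans le _.
by rewrite lef_pV2 ?posrE ?exprn_gt0 // -natrX ler_nat.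
Qed.

Lemma family_const A n x : computable_reals R A x ->
  computable_family A (fun _ : n.-tuple nat => x).
Proof.
move=> /computable_realP[P [M [D [rP rM rD H]]]].
exists (fun k _ => P k [tuple 0%N]), (fun k _ => M k [tuple 0%N]), (fun k _ => D k [tuple 0%N]).
have app Q : recursive A (fun w : 2.-tuple nat => Q (thead w) (tail w)) ->
    recursive A (fun w : n.+1.-tuple nat => Q (thead w) [tuple 0%N]).
  by move=> rQ; apply: (rec_app rQ (rec_head _ _) (rec_const _ _ 0%N)).
by split=> [| | |k v]; [exact: app rP|exact: app rM|exact: app rD|exact: H].
Qed.

Lemma family_horner A n (p : {poly R}) (g : n.-tuple nat -> R) :
  (forall i, computable_reals R A p`_i) -> computable_family A g ->
  computable_family A (fun v => p.[g v]).
Proof.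
move=> + rg; elim/poly_ind: p => [|p c IH] coef.
  apply: family_ext (family_nat (f := fun=> 0%N) (rec_const _ _ _)) => v.
  by rewrite horner0.
have rp : forall i, computable_reals R A p`_i.
  by move=> i; have := coef i.+1; rewrite coefD coefMX coefC /= addr0.
have rc : computable_reals R A c by have := coef 0%N; rewrite coefD coefMX coefC /= add0r.
apply: family_ext (family_add (family_mul (IH rp) rg) (family_const _ rc)) => v.
by rewrite hornerMXaddC.
Qed.

(** Search for a precision at which the approximation is further from 0 than its
    error; this search ends because the real is not 0. *)
Lemma family_sign A n (g : n.-tuple nat -> R) : computable_family A g ->
  (forall v, g v != 0) -> recursive A (fun v => nat_of_bool (g v < 0)).
Proof.
move=> [P [M [D [rP rM rD H]]]] g0.
pose f k v := (D k v < k.+1 * ((P k v - M k v) + (M k v - P k v)))%N.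
have rf : recursive A (fun w => nat_of_bool (f (thead w) (tail w))).
  apply: rec_leq (rec_succ rD) (rec_mul (rec_succ (rec_head _ _)) _).
  exact: rec_add (rec_sub rP rM) (rec_sub rM rP).
have distE k v : ((P k v - M k v) + (M k v - P k v))%N%:R = `|(P k v)%:R - (M k v)%:R| :> R.
  rewrite natrD; case: (leqP (P k v) (M k v)) => h.
    by rewrite (eqP (h : P k v - M k v == 0)%N) add0r natrB // ler0_norm ?opprB // subr_le0 ler_nat.
  rewrite (eqP (ltnW h : M k v - P k v == 0)%N) addr0 natrB 1?ltnW // ger0_norm // subr_ge0 ler_nat.
  exact: ltnW.
have fE k v : f k v = (k.+1%:R^-1 < `|signed_quotient (P k v) (M k v) (D k v)|).
  have [D0 _] := H k v.
  rewrite /signed_quotient normrM normfV -distE [`|(D k v)%:R|]ger0_norm // ltr_pdivlMr ?ltr0n //.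
  by rewrite mulrC ltr_pdivrMr // mulrC -natrM ltr_nat.
have ex v : exists k, f k v.
  have gv : 0 < `|g v| by rewrite normr_gt0.
  exists (Num.truncn (2 / `|g v|)); rewrite fE; set k := Num.truncn _.
  have [_ le] := H k v.
  have : 2 / `|g v| < k.+1%:R by exact: truncnS_gt.
  rewrite ltr_pdivrMr // => h.
  have h2 : 2 * k.+1%:R^-1 < `|g v| by rewrite ltr_pdivrMr // mulrC.
  have := ler_normD (g v - signed_quotient (P k v) (M k v) (D k v)) (signed_quotient (P k v) (M k v) (D k v)).
  rewrite subrK; move: h2 le; move: (_^-1) `|_ - _| `|signed_quotient _ _ _| `|g v| => e1 e2 e3 e4; lra.
have [h [rh hP]] := rec_mu rf ex.
have app Q : recursive A (fun w => Q (thead w) (tail w)) -> recursive A (fun v => Q (h v) v).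
  by move=> rQ; apply: rec_ext (rec_let rQ rh) => v; rewrite theadE tail_cons.
apply: rec_ext (rec_leq (rec_succ (app _ rP)) (app _ rM)) => v.
have [] := hP v; rewrite fE => + _; have [D0 le] := H (h v) v.
have Dp : 0 < (D (h v) v)%:R^-1 :> R by rewrite invr_gt0 ltr0n.
have -> : (P (h v) v < M (h v) v)%N = (signed_quotient (P (h v) v) (M (h v) v) (D (h v) v) < 0).
  by rewrite -(ltr_nat R) -subr_lt0 -(pmulr_llt0 _ Dp).
move: le; set r := signed_quotient _ _ _ => le lt; congr nat_of_bool.
move: le lt; move: (_.+1%:R^-1) r (g v) => e r y; rewrite ler_norml ltr_normr => /andP[l1 l2].
by case/orP => l3; apply/idP/idP => h0; lra.
Qed.

End Family.

(** * Locating a point on finer and finer grids *)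

Section Bisection.
Variable R : realType.
Implicit Type A : cantor_seq.

(** The grid points below c form an initial segment of the grid, so their number
    locates c. *)
Lemma count_grid (u c delta : R) K : 0 < delta -> (0 < K)%N ->
  u <= c -> c <= u + K%:R * delta ->
  let N := sum_below K (fun j => (u + j.+1%:R * delta < c)%R) in
  [/\ (N < K)%N, u + N%:R * delta <= c & c <= u + N.+1%:R * delta].
Proof.
move=> d0 K0 uc cK N.
have ex : exists m, c <= u + m.+1%:R * delta by exists K.-1; rewrite prednK.
case: (ex_minnP ex) => m cm mmin.
have mK : (m < K)%N by rewrite -(prednK K0) ltnS; apply: mmin; rewrite prednK.
have bit j : (u + j.+1%:R * delta < c) = (j < m)%N.
  case: (ltnP j m) => jm.
    by apply/negbNE; rewrite -leNgt; apply/negP => /mmin; rewrite leqNgt jm.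
  apply/negbTE; rewrite -leNgt; apply: le_trans cm _.
  by rewrite lerD2l ler_wpM2r ?(ltW d0) // ler_nat.
have -> : N = m.
  rewrite /N /sum_below; under eq_bigr do rewrite bit.
  suff -> : (\sum_(i < K) (i < m) = minn K m)%N by apply/minn_idPr/ltnW.
  by elim: (K) => [|k IH]; rewrite ?big_ord0 ?min0n // big_ord_recr /= IH; lia.
split=> //; case: (posnP m) => [->|m0]; first by rewrite mul0r addr0.
by rewrite -(prednK m0) ltW // bit prednK.
Qed.

(** The index is reduced modulo the size of the grid so that the point lies
    between u and v for all values of the variables: [family_sign] needs a
    family that vanishes nowhere. *)
Lemma family_grid A (u v : rat) : computable_family A
  (fun w : 2.-tuple nat => ratr u +
     ((thead w %% 2 ^ thead (tail w)).+1%:R * (2 ^ thead (tail w))%:R^-1) * ratr (v - u) : R).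
Proof.
apply: family_add; first exact: family_rat.
apply: family_mul; last exact: family_rat.
apply: family_mul.
  by apply: (family_nat R (f := fun w : 2.-tuple nat => (thead w %% 2 ^ thead (tail w)).+1%N)); rec_tac.
apply: (family_inv_nat R (f := fun w : 2.-tuple nat => (2 ^ thead (tail w))%N)); first by rec_tac.
by move=> w; rewrite expn_gt0.
Qed.

(** If p changes sign from negative to positive at c and vanishes at no rational
    point of the interval, comparing grid points with c amounts to computing
    signs of p. *)
Lemma computable_bisection A (p : {poly R}) (u v : rat) (c : R) :
  (forall i, computable_reals R A p`_i) -> u < v -> ratr u <= c <= ratr v ->
  (forall q : rat, u < q <= v ->
     p.[ratr q] != 0 /\ (p.[ratr q] < 0) = (ratr q < c)) ->
  exists2 N : nat -> nat, computable_from A N & forall n,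
    [/\ (N n < 2 ^ n)%N,
        ratr u + (N n)%:R * (ratr (v - u) / 2 ^+ n) <= c &
        c <= ratr u + (N n).+1%:R * (ratr (v - u) / 2 ^+ n)].
Proof.
move=> pA uv /andP[uc cv] sgn.
pose t n j : R := ratr u + (j.+1%:R * (2 ^ n)%:R^-1) * ratr (v - u).
have w0 : 0 < ratr (v - u) :> R by rewrite ltr0q subr_gt0.
have tE n j : (j < 2 ^ n)%N -> exists2 q : rat, u < q <= v & t n j = ratr q.
  move=> jn; exists (u + j.+1%:R * (2 ^ n)%:R^-1 * (v - u)); last first.
  by rewrite [RHS]rmorphD [in RHS]rmorphM [in RHS]rmorphM fmorphV !rmorph_nat.
  have p0 : 0 < (2 ^ n)%:R :> rat by rewrite ltr0n expn_gt0.
  rewrite ltrDl !mulr_gt0 ?subr_gt0 ?invr_gt0 //= -lerBrDl.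
  apply: ler_piMl; first by rewrite subr_ge0 ltW.
  by rewrite ler_pdivrMr // mul1r ler_nat.
pose g (w : 2.-tuple nat) := p.[t (thead (tail w)) (thead w %% 2 ^ thead (tail w))%N].
have rg : computable_family A g by apply: family_horner => //; exact: family_grid.
have g0 w : g w != 0.
  have p2 : (0 < 2 ^ thead (tail w))%N by rewrite expn_gt0.
  have [q qv qE] := tE _ _ (ltn_pmod (thead w) p2).
  by rewrite /g qE; have [] := sgn q qv.
pose N n := sum_below (2 ^ n) (fun j => (p.[t n (j %% 2 ^ n)%N] < 0)%R).
exists N.
  apply/computable_fromP; apply: (@rec_sum A 1 (fun j w =>
    nat_of_bool (p.[t (thead w) (j %% 2 ^ thead w)%N] < 0)%R) (fun w => (2 ^ thead w)%N)).
    exact: (family_sign rg g0).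
  by rec_tac.
move=> n; have p0 : 0 < 2 ^+ n :> R by rewrite exprn_gt0.
have -> : N n = sum_below (2 ^ n) (fun j => (ratr u + j.+1%:R * (ratr (v - u) / 2 ^+ n) < c)%R).
  apply: eq_bigr => j _; rewrite modn_small //; congr nat_of_bool.
  have [q qv qE] := tE n j (ltn_ord j); have [_ sg] := sgn q qv.
  by rewrite qE sg -qE /t natrX mulrAC -mulrA.
apply: count_grid; [exact: divr_gt0|by rewrite expn_gt0|by []|].
rewrite natrX mulrCA divff ?gt_eqF // mulr1 rmorphB /=.
by rewrite addrC subrK.
Qed.

Lemma computable_rat A (q : rat) : computable_reals R A (ratr q).
Proof. by apply/computable_realP; exact: family_rat. Qed.

Lemma computable_reals_limit A (N : nat -> nat) (u w : rat) (c : R) : computable_from A N ->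
  (forall n, `|c - (ratr u + (N n)%:R * (ratr w / 2 ^+ n))| <= ratr w / 2 ^+ n) ->
  computable_reals R A c.
Proof.
move=> /computable_fromP rN close.
have [e we] : exists e : nat, ratr w <= 2 ^+ e :> R.
  exists (Num.truncn (ratr w : R)).+1; apply: le_trans (ltW (truncnS_gt _)) _.
  by rewrite -natrX ler_nat ltnW // ltn_expl.
pose g (x : 1.-tuple nat) : R := ratr u + (N (thead x))%:R * ((2 ^ thead x)%:R^-1 * ratr w).
have : computable_family A g.
  apply: family_add; first exact: family_rat.
  apply: family_mul; first exact: (family_nat R (f := fun x : 1.-tuple nat => N (thead x)) rN).
  apply: family_mul; last exact: family_rat.
  apply: (family_inv_nat R (f := fun x : 1.-tuple nat => (2 ^ thead x)%N)); first by rec_tac.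
  by move=> x; rewrite expn_gt0.
move=> [P [M [D [rP rM rD H]]]]; apply/computable_realP.
have app (Q : nat -> 1.-tuple nat -> nat) : recursive A (fun w : 2.-tuple nat => Q (thead w) (tail w)) ->
    recursive A (fun w : 2.-tuple nat => Q (2 * thead w + 1)%N [tuple (thead w + 1 + e)%N]).
  move=> rQ.
  apply: (@rec_app A 2 Q (fun w => 2 * thead w + 1)%N (fun w => thead w + 1 + e)%N rQ); rec_tac.
exists (fun k _ => P (2 * k + 1)%N [tuple (k + 1 + e)%N]),
  (fun k _ => M (2 * k + 1)%N [tuple (k + 1 + e)%N]),
  (fun k _ => D (2 * k + 1)%N [tuple (k + 1 + e)%N]).
split=> [| | |k x]; [exact: app rP|exact: app rM|exact: app rD|].
have [D0 le] := H (2 * k + 1)%N [tuple (k + 1 + e)%N]; split=> //.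
have := close (k + 1 + e)%N.
have -> : (N (k + 1 + e)%N)%:R * (ratr w / 2 ^+ (k + 1 + e)) = g [tuple (k + 1 + e)%N] - ratr u.
  by rewrite /g theadE addrC addKr natrX; congr (_ * _); rewrite mulrC.
rewrite [ratr u + _]addrC subrK => le2.
(* The exponent k + 1 + e makes the error at most half of 1 / (k + 1). *)
have {}le2 : `|c - g [tuple (k + 1 + e)%N]| <= (2 * k + 1).+1%:R^-1.
  apply: le_trans le2 _; rewrite exprD ler_pdivrMr ?mulr_gt0 ?exprn_gt0 // mulrA.
  apply: le_trans we _; rewrite ler_peMl ?exprn_ge0 //.
  rewrite mulrC ler_pdivlMr // mul1r -natrX ler_nat (_ : (2 * k + 1).+1 = 2 * k.+1)%N; last by lia.
  by rewrite addn1 expnS leq_mul2l ltn_expl.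
move: le; set r := signed_quotient _ _ _ _ => le.
rewrite -[c](subrK (g [tuple (k + 1 + e)%N])) -addrA; apply: le_trans (ler_normD _ _) _.
apply: le_trans (lerD le2 le) _.
rewrite (_ : (2 * k + 1).+1 = 2 * k.+1)%N; last by lia.
rewrite natrM le_eqVlt; apply/orP; left; apply/eqP; field.
by rewrite nat1r pnatr_eq0.
Qed.

End Bisection.

(** * The reals of a Turing ideal *)

Section IdealReals.
Variables (R : realType) (I : set cantor_seq).
Hypothesis idealI : turing_ideal I.
Local Notation F := (ideal_reals R I).

Lemma computable_reals_turing_le A B : turing_le A B ->
  computable_reals R A `<=` computable_reals R B.
Proof.
by move=> AB x /computable_realP rx; apply/computable_realP; exact: family_turing_le AB rx.
Qed.

Lemma ideal_reals_common x y : F x -> F y ->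
  exists2 A, I A & computable_reals R A x /\ computable_reals R A y.
Proof.
move=> [A IA Ax] [B IB By]; have [_ _ join] := idealI.
exists (turing_join A B); first exact: join.
by split; [move: Ax|move: By]; apply: computable_reals_turing_le;
  [exact: turing_le_joinl|exact: turing_le_joinr].
Qed.

Lemma ideal_reals_rat q : F (ratr q).
Proof. by have [[A IA] _ _] := idealI; exists A => //; exact: computable_rat. Qed.

Lemma ideal_realsD x y : F x -> F y -> F (x + y).
Proof.
move=> Fx Fy; have [A IA [/computable_realP Ax /computable_realP Ay]] := ideal_reals_common Fx Fy.
by exists A => //; apply/computable_realP; exact: family_add.
Qed.

Lemma ideal_realsM x y : F x -> F y -> F (x * y).
Proof.
move=> Fx Fy; have [A IA [/computable_realP Ax /computable_realP Ay]] := ideal_reals_common Fx Fy.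
by exists A => //; apply/computable_realP; exact: family_mul.
Qed.

Lemma ideal_realsN x : F x -> F (- x).
Proof.
by move=> [A IA /computable_realP Ax]; exists A => //; apply/computable_realP; exact: family_opp.
Qed.

Lemma ideal_reals0 : F 0.
Proof. by have := ideal_reals_rat 0; rewrite rmorph0. Qed.

Lemma ideal_reals1 : F 1.
Proof. by have := ideal_reals_rat 1; rewrite rmorph1. Qed.

Lemma ideal_reals_coefs (p : {poly R}) : (forall i, F p`_i) ->
  exists2 A, I A & forall i, computable_reals R A p`_i.
Proof.
elim/poly_ind: p => [|p c IH] Fp.
  have [[A IA] _ _] := idealI; exists A => // i.
  by rewrite coef0 -(rmorph0 (ratr : rat -> R)); exact: computable_rat.
have Fc : F c by have := Fp 0%N; rewrite coefD coefMX coefC /= add0r.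
have [|A IA Ap] := IH.
  by move=> i; have := Fp i.+1; rewrite coefD coefMX coefC /= addr0.
have [B IB Bc] := Fc; have [_ _ join] := idealI.
exists (turing_join A B); first exact: join.
case=> [|i]; rewrite coefD coefMX coefC /= ?add0r ?addr0.
  by move: Bc; exact/computable_reals_turing_le/turing_le_joinr.
by move: (Ap i); exact/computable_reals_turing_le/turing_le_joinl.
Qed.

(** Write p = q * ('X - c).  Then q(c) = p'(c) > 0, and q stays positive near c. *)
Lemma simple_root_isolation (p : {poly R}) c : root p c -> p^`().[c] > 0 ->
  exists2 e, 0 < e & forall t, `|t - c| < e -> t != c ->
    p.[t] != 0 /\ (p.[t] < 0) = (t < c).
Proof.
move=> /factor_theorem[q pE]; rewrite pE derivM derivXsubC mulr1 hornerD.
rewrite hornerM hornerXsubC subrr mulr0 add0r => qc.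
have := @continuous_horner R q c.
move=> /cvgrPdist_lt /(_ _ qc) [e /= e0 he]; exists e => // t te tc.
have qt : 0 < q.[t].
  have : `|c - t| < e by rewrite distrC.
  by move=> /he /=; rewrite ltr_norml => /andP[_]; lra.
by rewrite hornerM hornerXsubC mulf_eq0 subr_eq0 (gt_eqF qt) (negPf tc) pmulr_rlt0 // subr_lt0.
Qed.

(** By induction on the degree p can be replaced by its derivative until the root
    is simple.  Rational roots are set aside, so that p does not vanish at
    rational points near the root. *)
Lemma ideal_reals_root (p : {poly R}) c : p != 0 -> (forall i, F p`_i) ->
  root p c -> F c.
Proof.
have [n] := ubnP (size p); elim: n p => // n IH p; rewrite ltnS => pn p0 Fp pc.
have [p'c|p'c] := eqVneq p^`().[c] 0.
  have p1 : (1 < size p)%N by exact: root_size_gt1 pc.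
  apply: (IH p^`()).
  - exact: leq_trans (lt_size_deriv p0) pn.
  - apply/eqP => /(congr1 (fun q : {poly R} => q`_(size p).-2)).
    rewrite coef_deriv coef0; have -> : (size p).-2.+1 = (size p).-1 by lia.
    move/eqP; rewrite mulrn_eq0 -lead_coefE lead_coef_eq0 (negPf p0) orbF.
    by apply/negP; lia.
  - move=> i; rewrite coef_deriv -mulr_natr; apply: ideal_realsM => //.
    by rewrite -(ratr_nat R); exact: ideal_reals_rat.
  - exact/eqP.
case: (pselect (exists q : rat, c = ratr q)) => [[q ->]|irr]; first exact: ideal_reals_rat.
wlog pos : p {pn} p0 Fp pc p'c / 0 < p^`().[c].
  move=> wl; case: (ltrgt0P p^`().[c]) => h; first exact: (wl p).
    apply: (wl (- p)); rewrite ?oppr_eq0 ?rootN ?derivN ?hornerN ?oppr_eq0 ?oppr_gt0 //.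
    by move=> i; rewrite coefN; exact: ideal_realsN.
  by rewrite h eqxx in p'c.
have [e e0 he] := simple_root_isolation pc pos.
have [A IA Ap] := ideal_reals_coefs Fp.
have /rat_in_itvoo[u] : c - e < c by rewrite ltrBlDr ltrDl.
rewrite in_itv /= => /andP[u1 u2].
have /rat_in_itvoo[v] : c < c + e by rewrite ltrDl.
rewrite in_itv /= => /andP[v1 v2].
have uv : u < v by rewrite -(ltr_rat R); exact: lt_trans v1.
have [||N rN HN] := @computable_bisection R A p u v c Ap uv.
- by rewrite !ltW.
- move=> q /andP[uq qv]; apply: he.
    rewrite -(ltr_rat R) in uq; rewrite -(ler_rat R) in qv.
    by rewrite ltr_norml; apply/andP; split; lra.
  by apply/eqP => qc; apply: irr; exists q.
exists A => //; apply: (computable_reals_limit (u := u) (w := v - u) rN) => m.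
have [_ l1 l2] := HN m; rewrite -natr1 mulrDl mul1r addrA in l2.
by rewrite ger0_norm ?subr_ge0 // lerBlDl.
Qed.

(** The inverse of x is the root of x T - 1. *)
Lemma ideal_realsV x : F x -> F x^-1.
Proof.
move=> Fx; have [->|x0] := eqVneq x 0; first by rewrite invr0; exact: ideal_reals0.
apply: (@ideal_reals_root (x%:P * 'X - 1%:P)).
- apply/eqP => /(congr1 (fun p => p.[0])).
  by rewrite hornerD hornerN hornerM hornerX !hornerC mulr0 add0r => /eqP; rewrite oppr_eq0 oner_eq0.
- move=> i; rewrite coefB coefMX !coefC; case: i => [|i] /=.
    by rewrite add0r; apply: ideal_realsN; exact: ideal_reals1.
  by rewrite subr0; case: i => [|i] //=; exact: ideal_reals0.
- by rewrite rootE hornerD hornerN hornerM hornerX !hornerC mulfV // subrr.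
Qed.

(** The integer part of 2 ^ n x is computed by integer division if x is rational,
    and otherwise by counting grid points below x, no grid point being equal to
    x.  These two algorithms are not uniform in x. *)
Lemma binary_expansion x : F x -> 0 <= x < 1 -> exists2 X, I X &
  forall n, (head_bits X n)%:R <= x * 2 ^+ n < (head_bits X n).+1%:R.
Proof.
move=> [A IA Ax] /andP[x0 x1].
have [N rN HN] : exists2 N : nat -> nat, computable_from A N &
    forall n, (N n)%:R <= x * 2 ^+ n < (N n).+1%:R.
  case: (pselect (exists q : rat, x = ratr q)) => [[q xq]|irr].
    have q0 : 0 <= q by rewrite -(ler0q R) -xq.
    pose a := `|numq q|%N; pose b := `|denq q|%N.
    have b0 : (0 < b)%N by rewrite absz_gt0 denq_neq0.
    have xE : x = a%:R / b%:R.
      rewrite xq /ratr -[numq q in LHS]gez0_abs ?numq_ge0 //.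
      by rewrite -[denq q in LHS]gez0_abs ?denq_ge0.
    exists (fun n => a * 2 ^ n %/ b)%N; first by apply/computable_fromP; rec_tac.
    have bp : 0 < b%:R :> R by rewrite ltr0n.
    move=> n; rewrite xE mulrAC -natrX -natrM ler_pdivlMr // ltr_pdivrMr //.
    by rewrite -!natrM ler_nat ltr_nat leq_divM ltn_ceil.
  have lr : (ratr 0 : R) <= x <= ratr 1 by rewrite rmorph0 rmorph1 x0 ltW.
  have [||N rN HN] := @computable_bisection R A ('X - x%:P) 0 1 x _ ltr01 lr.
  - move=> i; rewrite coefB coefX coefC; case: i => [|i] /=.
      rewrite sub0r; apply/computable_realP; apply: family_opp; exact/computable_realP.
    by rewrite subr0 -(ratr_nat R); exact: computable_rat.
  - move=> q _; rewrite hornerXsubC subr_eq0 subr_lt0; split=> //.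
    by apply/eqP => qx; apply: irr; exists q.
  exists N => // n; have [_ l1 l2] := HN n.
  have p0 : 0 < 2 ^+ n :> R by rewrite exprn_gt0.
  rewrite subr0 rmorph0 rmorph1 !add0r !mul1r -!(mulrC (2 ^+ n)^-1) in l1 l2.
  rewrite ler_pdivrMl // mulrC in l1; rewrite ler_pdivlMl // mulrC in l2.
  rewrite l1 /= lt_neqAle l2 andbT; apply/eqP => xN; apply: irr.
  exists ((N n).+1%:R / 2 ^+ n); rewrite fmorph_div rmorphXn /= !ratr_nat -xN.
  by rewrite mulfK // gt_eqF.
pose X : cantor_seq := fun j => odd (N j.+1).
have NE n k : k%:R <= x * 2 ^+ n < k.+1%:R -> k = N n.
  move=> /andP[l1 l2]; have /andP[l3 l4] := HN n.
  have : (k < (N n).+1)%N by rewrite -(ltr_nat R); exact: le_lt_trans l4.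
  have : (N n < k.+1)%N by rewrite -(ltr_nat R); exact: le_lt_trans l2.
  by rewrite !ltnS => h1 h2; apply/eqP; rewrite eqn_leq h1 h2.
have hX n : head_bits X n = N n.
  elim: n => [|n IH] /=; first by apply: NE; rewrite expr0 mulr1 x0.
  have -> : head_bits X n = (N n.+1 %/ 2)%N.
    rewrite IH; apply/esym/NE; have /andP[l1 l2] := HN n.+1.
    have e := divn_eq (N n.+1) 2; have m2 := ltn_pmod (N n.+1) (isT : (0 < 2)%N).
    rewrite exprS in l1 l2; set y := x * 2 ^+ n.
    have -> : y = (x * (2 * 2 ^+ n)) / 2 by rewrite /y; field.
    rewrite ler_pdivlMr // ltr_pdivrMr // -!natrM; apply/andP; split.
      by apply: le_trans l1; rewrite ler_nat {2}e leq_addr.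
    by apply: lt_le_trans l2 _; rewrite ler_nat; lia.
  by rewrite /X -modn2 mulnC -divn_eq.
have [_ down _] := idealI.
exists X; last by move=> n; rewrite hX.
apply: down IA _; apply/computable_fromP; apply: rec_odd.
by apply: (rec_comp1 (f := N)); [exact/computable_fromP|exact: rec_succ (rec_head _ _)].
Qed.

Lemma dyadic_le (a n k : nat) : (k <= n)%N ->
  (a %/ 2 ^ (n - k))%N%:R / 2 ^+ k <= a%:R / 2 ^+ n :> R.
Proof.
move=> kn; rewrite ler_pdivrMr ?exprn_gt0 // mulrAC ler_pdivlMr ?exprn_gt0 //.
have e : (2 ^ n = 2 ^ (n - k) * 2 ^ k)%N by rewrite -expnD subnK.
by rewrite -!natrX -!natrM ler_nat e mulnA leq_mul2r leq_divM orbT.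
Qed.

(** The real with binary digits X. *)
Definition real_of (X : cantor_seq) : R :=
  sup (range (fun n => (head_bits X n)%:R / 2 ^+ n)).

Lemma real_of_bounds X n :
  (head_bits X n)%:R / 2 ^+ n <= real_of X <= (head_bits X n).+1%:R / 2 ^+ n.
Proof.
have p0 k : 0 < 2 ^+ k :> R by rewrite exprn_gt0.
have ub k l : (head_bits X k)%:R / 2 ^+ k <= (head_bits X l).+1%:R / 2 ^+ l :> R.
  case: (leqP k l) => kl.
    have := dyadic_le (head_bits X l) kl; rewrite -{1}(subnKC kl) head_bits_div => /le_trans; apply.
    by rewrite ler_pM2r ?invr_gt0 // ler_nat.
  rewrite ler_pdivrMr // mulrAC ler_pdivlMr //.
  have e : (2 ^ k = 2 ^ (k - l) * 2 ^ l)%N by rewrite -expnD subnK // ltnW.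
  rewrite -!natrX -!natrM ler_nat e mulnA leq_mul2r.
  apply/orP; right; apply: ltnW; rewrite -ltn_divLR ?expn_gt0 //.
  by rewrite -{1}(subnKC (ltnW kl)) head_bits_div.
apply/andP; split.
  apply: ub_le_sup; last by exists n.
  by exists ((head_bits X n).+1%:R / 2 ^+ n) => _ [k _ <-].
apply: ge_sup; first by exists ((head_bits X n)%:R / 2 ^+ n); exists n.
by move=> _ [k _ <-].
Qed.

Lemma real_of_close X Y n : `|real_of X - real_of Y| <= 2 ^- n ->
  (head_bits X n <= head_bits Y n + 2)%N.
Proof.
have p0 : 0 < 2 ^+ n :> R by rewrite exprn_gt0.
have /andP[x1 _] := real_of_bounds X n; have /andP[_ y2] := real_of_bounds Y n.
rewrite ler_norml => /andP[_ h]; rewrite -(ler_nat R) natrD.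
move: x1 y2; rewrite ler_pdivrMr // ler_pdivlMr // -natr1 => x1 y2.
have := ler_wpM2r (ltW p0) h; rewrite mulVf ?gt_eqF // mulrBl; lra.
Qed.

Lemma ideal_reals_real_of X : I X -> F (real_of X).
Proof.
move=> IX; exists X => //.
have rX : computable_from X (head_bits X).
  by apply/computable_fromP; apply: rec_head_bits; [exact: turing_le_refl|exact: rec_head].
apply: (computable_reals_limit (u := 0) (w := 1) rX) => n.
have /andP[l1 l2] := real_of_bounds X n; rewrite rmorph0 rmorph1 add0r mul1r.
by rewrite ger0_norm ?subr_ge0 // lerBlDl -[X in _ + X]mul1r -mulrDl natr1.
Qed.

End IdealReals.

(** * A root-closed subset of the reals is a real closed field *)

(** The closure properties are bundled with the set so that the algebraic
    structures below can be attached to the subtype. *)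
Record root_closed_set (R : realType) := RootClosedSet {
  carrier :> set R;
  carrier1 : carrier 1;
  carrierB : forall x y, carrier x -> carrier y -> carrier (x - y);
  carrierM : forall x y, carrier x -> carrier y -> carrier (x * y);
  carrierV : forall x, carrier x -> carrier x^-1;
  carrier_root : forall (p : {poly R}) c, p != 0 -> (forall i, carrier p`_i) ->
    root p c -> carrier c }.

Section RootClosedField.
Variables (R : realType) (S : root_closed_set R).

Definition in_carrier : pred R := fun x => `[< carrier S x >].

Lemma in_carrier_divring : divring_closed in_carrier.
Proof.
split=> [|x y|x y]; rewrite !unfold_in /in_carrier.
- exact/asboolP/carrier1.
- by move=> /asboolP Sx /asboolP Sy; exact/asboolP/carrierB.
- by move=> /asboolP Sx /asboolP Sy; apply/asboolP/carrierM => //; exact: carrierV.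
Qed.

HB.instance Definition _ := GRing.isDivringClosed.Build R in_carrier in_carrier_divring.

Record subreal := SubReal { subreal_val :> R; subreal_valP : subreal_val \in in_carrier }.

HB.instance Definition _ := [isSub for subreal_val].
HB.instance Definition _ := [Choice of subreal by <:].
HB.instance Definition _ := [SubChoice_isSubIntegralDomain of subreal by <:].
HB.instance Definition _ := [SubIntegralDomain_isSubField of subreal by <:].

Definition subreal_le (x y : subreal) := val x <= val y.
Definition subreal_lt (x y : subreal) := val x < val y.
Definition subreal_norm (x : subreal) := if subreal_le 0 x then x else - x.

Fact subreal_le0D x y : subreal_le 0 x -> subreal_le 0 y -> subreal_le 0 (x + y).
Proof. by rewrite /subreal_le raddf0 raddfD; exact: addr_ge0. Qed.

Fact subreal_le0M x y : subreal_le 0 x -> subreal_le 0 y -> subreal_le 0 (x * y).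
Proof. by rewrite /subreal_le raddf0 rmorphM; exact: mulr_ge0. Qed.

Fact subreal_le0_anti x : subreal_le 0 x -> subreal_le x 0 -> x = 0.
Proof.
rewrite /subreal_le raddf0 => x0 x1; apply: val_inj; apply/eqP.
by rewrite /= eq_le; apply/andP.
Qed.

Fact subreal_sub_ge0 x y : subreal_le 0 (y - x) = subreal_le x y.
Proof. by rewrite /subreal_le raddf0 raddfB subr_ge0. Qed.

Fact subreal_le0_total x : subreal_le 0 x || subreal_le x 0.
Proof. by rewrite /subreal_le; exact: le_total. Qed.

Fact subreal_normN x : subreal_norm (- x) = subreal_norm x.
Proof.
rewrite /subreal_norm /subreal_le raddf0 raddfN oppr_ge0 opprK.
case: (ltgtP 0 (val x)) => // x0.
by apply: val_inj; rewrite raddfN /= -x0 oppr0.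
Qed.

Fact subreal_ge0_norm x : subreal_le 0 x -> subreal_norm x = x.
Proof. by rewrite /subreal_norm => ->. Qed.

Fact subreal_lt_def x y : subreal_lt x y = (y != x) && subreal_le x y.
Proof. by rewrite /subreal_lt lt_def. Qed.

HB.instance Definition _ := Num.IntegralDomain_isLeReal.Build subreal
  subreal_le0D subreal_le0M subreal_le0_anti subreal_sub_ge0 subreal_le0_total
  subreal_normN subreal_ge0_norm subreal_lt_def.

(** The intermediate value property of R provides a root in R of the polynomial,
    and this root is in the set by closure under roots. *)
Fact subreal_closed : Num.real_closed_axiom subreal.
Proof.
move=> p a b ab /andP[pa pb].
have [->|p0] := eqVneq p 0; first by exists a; rewrite ?lexx ?ab ?root0.
have hv (x : subreal) : val p.[x] = (map_poly val p).[val x] by rewrite horner_map.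
have [|c /andP[ac cb] pc] := @poly_ivt R (map_poly val p) (val a) (val b) ab.
  by rewrite -!hv; apply/andP; split; [exact: pa|exact: pb].
have Sc : c \in in_carrier.
  apply/asboolP; apply: (carrier_root _ _ pc); first by rewrite map_poly_eq0.
  by move=> i; rewrite coef_map; exact/asboolP/(valP p`_i).
exists (SubReal Sc); first by apply/andP; split; [exact: ac|exact: cb].
by move: pc; rewrite -(fmorph_root (val : {rmorphism subreal -> R})).
Qed.

HB.instance Definition _ := Num.RealField_isClosed.Build subreal subreal_closed.

Lemma root_closed_set_real_closed : real_closed_subfield (carrier S).
Proof.
exists (subreal : rcfType), (val : {rmorphism subreal -> R}); split=> [x y //|].
apply/seteqP; split=> [_ [x _ <-]|x Sx]; first exact/asboolP/(valP x).
have Sx' : x \in in_carrier by exact/asboolP.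
by exists (SubReal Sx').
Qed.

End RootClosedField.

(** * The dimensions *)

Section Dimension.
Variable R : realType.

Lemma real_dist_ge0 (x y : R) : 0 <= real_dist x y.
Proof. exact: normr_ge0. Qed.

Lemma cantor_dist_ge0 X Y : 0 <= cantor_dist R X Y.
Proof. by rewrite /cantor_dist; case: pselect => // neq; rewrite invr_ge0 exprn_ge0. Qed.

Lemma cantor_dist_le X Y n : cantor_dist R X Y <= 2 ^- n <-> head_bits X n = head_bits Y n.
Proof.
rewrite head_bits_eqP /cantor_dist; case: pselect => [neq|eqXY]; last first.
  split=> _; last by rewrite invr_ge0 exprn_ge0.
  by move=> i _; apply/eqP/negPn/negP => ne; apply: eqXY; exists i.
case: ex_minnP => m ne mmin; rewrite lef_pV2 ?posrE ?exprn_gt0 // ler_eXn2l ?ltr1n //.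
split=> [nm i im|agree].
  apply/eqP/negPn/negP => /mmin; rewrite leqNgt => /negP[]; exact: leq_trans nm.
by rewrite leqNgt; apply/negP => /agree e; rewrite e eqxx in ne.
Qed.

Lemma size_filter_below h (P : pred nat) : size [seq x <- iota 0 h | P x] = sum_below h P.
Proof.
rewrite size_filter -sum1_count big_mkcond /sum_below.
by rewrite (_ : iota 0 h = index_iota 0 h) ?big_mkord //; rewrite /index_iota subn0.
Qed.

(** The cylinder of a prefix of length n has diameter at most 2 ^ - n. *)
Lemma cantor_null_of_sparsely_covered (s s' : R) I : 0 <= s' -> s < s' -> sparsely_covered s I ->
  hausdorff_measure (@cantor_dist R) s' I = 0%E.
Proof.
move=> s0 ss [V [C [few cov]]].
pose W n := [seq [set X | head_bits X n = x] | x <- [seq x <- iota 0 (2 ^ n) | V n x]].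
apply: (hausdorff_measure_limsup_eq0 cantor_dist_ge0 (W := W) (C := C) s0 ss).
- move=> n i X Y; rewrite /W; set l := [seq x <- iota 0 _ | _].
  case: (ltnP i (size l)) => il; last by rewrite nth_default ?size_map.
  by rewrite (nth_map 0%N) //= => Xi Yi; apply/cantor_dist_le; rewrite Xi Yi.
- by move=> n; rewrite size_map size_filter_below.
- move=> X IX N; have [n [Nn Vn]] := cov X IX N; exists n; split=> //.
  have mem : head_bits X n \in [seq x <- iota 0 (2 ^ n) | V n x].
    by rewrite mem_filter Vn mem_iota head_bits_lt.
  exists (index (head_bits X n) [seq x <- iota 0 (2 ^ n) | V n x]).
  by rewrite /W (nth_map 0%N) ?index_mem //= nth_index.
Qed.

Lemma linear_le_exp (e : R) : 0 < e -> exists2 K : R, 0 <= K &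
  forall n, (2 * n + 1)%N%:R <= K * 2 `^ (e * n%:R).
Proof.
move=> e0; have l0 : 0 < ln 2 :> R by rewrite ln_gt0 // ltr1n.
have el : 0 < e * ln 2 by rewrite mulr_gt0.
exists (2 / (e * ln 2) + 1); first by rewrite addr_ge0 // divr_ge0 // ltW.
move=> n; have -> : 2 `^ (e * n%:R) = expR (n%:R * (e * ln 2)) :> R.
  by rewrite /powR pnatr_eq0 /=; congr expR; ring.
have n0 : 0 <= n%:R * (e * ln 2) by rewrite mulr_ge0 // ltW.
have := expR_ge1Dx (n%:R * (e * ln 2)); set E := expR _ => h.
have E1 : 1 <= E by lra.
have h2 : 2 * n%:R <= 2 / (e * ln 2) * E.
  rewrite -mulrA ler_wpM2l // mulrC ler_pdivlMr //; lra.
have -> : (2 * n + 1)%N%:R = 2 * n%:R + 1 :> R by rewrite natrD natrM.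
by rewrite [leRHS]mulrDl mul1r lerD.
Qed.

(** At length n the dyadic intervals are translated by the integers between - n
    and n, which cover any given real once n is large.  The factor 2 n + 1 is
    absorbed by half of the difference between s and s'. *)
Lemma real_null_of_sparsely_covered (s s' : R) I : turing_ideal I -> 0 <= s' -> s < s' -> sparsely_covered s I ->
  hausdorff_measure (@real_dist R) s' (ideal_reals R I) = 0%E.
Proof.
move=> idI s0 ss [V [C [few cov]]].
pose idx n := [seq (k, x) | k <- iota 0 (2 * n + 1), x <- [seq x <- iota 0 (2 ^ n) | V n x]].
pose J n (p : nat * nat) := [set y : R |
  p.1%:R - n%:R + p.2%:R / 2 ^+ n <= y <= p.1%:R - n%:R + p.2.+1%:R / 2 ^+ n].
pose W n := [seq J n p | p <- idx n].
have [|K K0 HK] := @linear_le_exp ((s' - s) / 2); first by rewrite divr_gt0 ?subr_gt0.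
apply: (hausdorff_measure_limsup_eq0 real_dist_ge0 (s := s + (s' - s) / 2) (W := W) (C := K * C) s0).
- by rewrite -ltrBrDl ltr_pdivrMr // ltr_pMr ?subr_gt0 // ltr1n.
- move=> n i x y; rewrite /W.
  case: (ltnP i (size (idx n))) => il; last by rewrite nth_default ?size_map.
  rewrite !(nth_map (0, 0)%N) //; case: (nth _ _ _) => k z; rewrite /J /= => /andP[x1 x2] /andP[y1 y2].
  rewrite -natr1 mulrDl mul1r in x2 y2.
  by rewrite /real_dist ler_norml; apply/andP; split; lra.
- move=> n; rewrite size_map size_allpairs size_iota size_filter_below natrM.
  rewrite mulrDl powRD ?pnatr_eq0 ?implybT // [2 `^ _ * _]mulrC mulrACA.
  by rewrite ler_pM.
- move=> y Fy N; pose k := Num.floor y.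
  have ky : k%:~R <= y < k%:~R + 1 by rewrite floor_le_tmp /= -intrD1 floorD1_gt.
  have Fz : ideal_reals R I (y - k%:~R).
    apply: ideal_realsD => //; apply: ideal_realsN; rewrite -(ratr_int R); exact: ideal_reals_rat.
  have z01 : 0 <= y - k%:~R < 1 by lra.
  have [X IX HX] := binary_expansion idI Fz z01.
  have [n [Nn Vn]] := cov X IX (maxn N `|k|%N).
  exists n; split; first by apply: leq_trans Nn; exact: leq_maxl.
  have kn : (`|k| <= n)%N by apply: leq_trans Nn; exact: leq_maxr.
  pose m := `|(k + n%:Z)%R|%N.
  have mE : m%:Z = k + n%:Z by rewrite /m; lia.
  have mem : (m, head_bits X n) \in idx n.
    apply/allpairsP; exists (m, head_bits X n); split=> //=.
      by rewrite mem_iota add0n leq0n /=; lia.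
    by rewrite mem_filter Vn mem_iota head_bits_lt.
  exists (index (m, head_bits X n) (idx n)).
  rewrite /W (nth_map (0, 0)%N) ?index_mem // nth_index // /J /=.
  have -> : m%:R - n%:R = k%:~R :> R.
    by rewrite (_ : m%:R = m%:Z%:~R :> R) // mE intrD addrK.
  have p0 : 0 < 2 ^+ n :> R by rewrite exprn_gt0.
  have /andP[h1 h2] := HX n.
  apply/andP; split; [rewrite -lerBrDl ler_pdivrMr //|rewrite -lerBlDl ler_pdivlMr //].
  exact: ltW.
Qed.

(** The loss of an arbitrarily small amount in the exponent disappears in the
    infimum. *)
Lemma hausdorff_dim_sparsely_covered T (d : T -> T -> R) (E : set T) I :
  (forall s, 0 <= s -> hausdorff_measure d s E = 0%E -> sparsely_covered s I) ->
  (forall s s', 0 <= s' -> s < s' -> sparsely_covered s I -> hausdorff_measure d s' E = 0%E) ->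
  hausdorff_dim d E = ereal_inf [set s%:E | s in [set s : R | 0 <= s /\ sparsely_covered s I]].
Proof.
move=> null_small small_null; apply/eqP; rewrite eq_le; apply/andP; split; last first.
  apply: ereal_inf_le_tmp => _ [s [s0 Hs] <-]; exists s => //; split=> //.
  exact: null_small.
apply: le_ereal_inf_tmp => _ [s [s0 Hs] <-].
apply/lee_addgt0Pr => e e0; rewrite -EFinD; apply: ereal_inf_lbound.
exists (s + e) => //; split; first by rewrite addr_ge0 // ltW.
by apply: small_null Hs; [rewrite addr_ge0 // ltW|rewrite ltrDl].
Qed.

Lemma sparsely_covered1 I : @sparsely_covered R 1 I.
Proof.
exists (fun _ _ => true), 1; split=> [n|X _ N]; last by exists N.
by rewrite !mul1r powR2_nat /sum_below sum1_card card_ord.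
Qed.

(** An exponent below 1 gives all exponents 2 / a; otherwise the infimum is at
    least 1, and all prefixes together are a cover of exponent 1. *)
Lemma sparsely_covered_dim I : turing_ideal I ->
  let D := ereal_inf [set s%:E | s in [set s : R | 0 <= s /\ sparsely_covered s I]] in
  D = 0%E \/ D = 1%E.
Proof.
move=> idI D.
case: (pselect (exists2 t : R, t < 1 & sparsely_covered t I)) => [[t t1 st]|none].
  left; apply/eqP; rewrite eq_le; apply/andP; split; last first.
    by apply: le_ereal_inf_tmp => _ [s [s0 _] <-]; rewrite lee_fin.
  apply/lee_addgt0Pr => e e0; rewrite add0e.
  pose a := (Num.truncn (2 / e)).+1.
  apply: (@le_trans _ _ (2 / a%:R)%:E).
    apply: ereal_inf_lbound; exists (2 / a%:R) => //; split; first exact: divr_ge0.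
    exact: sparsely_covered_zero_one st _.
  rewrite lee_fin ler_pdivrMr // mulrC -ler_pdivrMr //.
  exact/ltW/truncnS_gt.
right; apply/eqP; rewrite eq_le; apply/andP; split.
  by apply: ereal_inf_lbound; exists 1 => //; split=> //; exact: sparsely_covered1.
apply: le_ereal_inf_tmp => _ [s [s0 ss] <-]; rewrite lee_fin leNgt.
by apply/negP => s1; apply: none; exists s.
Qed.

Lemma ideal_reals_real_closed I : turing_ideal I -> real_closed_subfield (ideal_reals R I).
Proof.
move=> idI.
have FB x y : ideal_reals R I x -> ideal_reals R I y -> ideal_reals R I (x - y).
  by move=> Fx Fy; apply: ideal_realsD => //; exact: ideal_realsN.
exact: (root_closed_set_real_closed (RootClosedSet (ideal_reals1 R idI) FB
  (@ideal_realsM R I idI) (@ideal_realsV R I idI) (@ideal_reals_root R I idI))).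
Qed.

End Dimension.

Local Open Scope ereal_scope.

Theorem theorem1p3 (R : realType) (I : set (nat -> bool))
    (hI : turing_ideal I) :
  real_closed_subfield (ideal_reals R I) /\
  hausdorff_dim (@cantor_dist R) I =
    hausdorff_dim (@real_dist R) (ideal_reals R I) /\
  (hausdorff_dim (@real_dist R) (ideal_reals R I) = 0 \/
   hausdorff_dim (@real_dist R) (ideal_reals R I) = 1).
Proof.
have cantor_dim : hausdorff_dim (@cantor_dist R) I =
    ereal_inf [set s%:E | s in [set s : R | (0 <= s)%R /\ sparsely_covered s I]].
  apply: hausdorff_dim_sparsely_covered => [s s0|s s' s0]; last exact: cantor_null_of_sparsely_covered.
  apply: (sparsely_covered_of_null (@cantor_dist_ge0 R) (phi := id)) => // X Y n /cantor_dist_le ->.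
  exact: leq_addr.
have real_dim : hausdorff_dim (@real_dist R) (ideal_reals R I) =
    ereal_inf [set s%:E | s in [set s : R | (0 <= s)%R /\ sparsely_covered s I]].
  apply: hausdorff_dim_sparsely_covered => [s s0|s s' s0]; last exact: real_null_of_sparsely_covered.
  apply: (sparsely_covered_of_null (@real_dist_ge0 R) (phi := @real_of R)) => // X.
    exact: ideal_reals_real_of.
  by move=> Y n; exact: real_of_close.
split; first exact: ideal_reals_real_closed.
by rewrite cantor_dim real_dim; split=> //; exact: sparsely_covered_dim.
Qed.
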